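(* Let $a,b,c$ be integers with $a>0$, put $-d=b^2-4ac$, and suppose $\tau=\frac{-b+\sqrt{-d}}{2a}$ lies in $C_{1/J,\,\infty}$ (so $d>0$ and $\sqrt{-d}=i\sqrt d$). Let $J=J(\tau)$ and $F={}_{2}F_{1}\left(\frac1{12},\frac5{12};1;\frac1J\right)$. Then $$\frac{a}{\pi\sqrt d}\,\frac{\sqrt J}{\sqrt{J-1}}=F^2\,\frac{1-s_2(\tau)}{6}-J\frac{d}{dJ}F^2,$$ where the principal branch of the square root is used. (Here $\frac{d}{dJ}F^2$ is the derivative of $F^2$ regarded as a function of $J$.)
   Context: For $\tau$ in the upper half-plane $\mathfrak H$ and $q=e^{2\pi i\tau}$: $E_2(\tau)=1-24\sum_{n\ge1}\frac{nq^n}{1-q^n}$, $E_4(\tau)=1+240\sum_{n\ge1}\frac{n^3q^n}{1-q^n}$, $E_6(\tau)=1-504\sum_{n\ge1}\frac{n^5q^n}{1-q^n}$; the absolute Klein invariant is $J(\tau)=\frac{E_4(\tau)^3}{E_4(\tau)^3-E_6(\tau)^2}$ (so $J=j/12^3$ with $j$ the classical $j$-invariant); $$s_2(\tau)=\frac{E_4(\tau)}{E_6(\tau)}\left(E_2(\tau)-\frac{3}{\pi\,\mathrm{Im}(\tau)}\right).$$ ${}_2F_1(a,b;c;z)=\sum_{n\ge0}\frac{(a)_n(b)_n}{(c)_n}\frac{z^n}{n!}$ is the hypergeometric series, with $(x)_n=x(x+1)\cdots(x+n-1)$, $(x)_0=1$. Let $\mathcal F=\{\tau\in\mathfrak H: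 |\mathrm{Re}(\tau)|<1/2,\ |\tau|>1\}$. $C_{1/J,\,\infty}$ denotes the connected component of the open set $\{\tau\in\mathcal F: |1/J(\tau)|<1\}$ whose closure contains the cusp $\infty$ (i.e. which contains points of arbitrarily large imaginary part). *)

(* Defs.v *)
From HB Require Import structures.
From mathcomp Require Import all_boot all_order all_algebra.
From mathcomp Require Import complex.
From mathcomp Require Import all_classical all_reals all_analysis.

Set Implicit Arguments.
Unset Strict Implicit.
Unset Printing Implicit Defensive.

Import Order.TTheory GRing.Theory Num.Theory.
Import numFieldNormedType.Exports.

Local Open Scope classical_set_scope.
Local Open Scope complex_scope.
Local Open Scope ring_scope.

(* The topology of R[i] is the one that MathComp-Analysis puts on every        *)
(* numFieldType, so derive1 on R[i] -> R[i] is the complex derivative.         *)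
#[non_forgetful_inheritance]
HB.instance Definition _ (R : rcfType) := GRing.ComAlgebra.copy R[i] (R[i])^o.
#[non_forgetful_inheritance]
HB.instance Definition _ (R : rcfType) := Vector.copy R[i] (R[i])^o.
#[non_forgetful_inheritance]
HB.instance Definition _ (R : rcfType) := NormedModule.copy R[i] (R[i])^o.

Section Definitions.
Variable R : realType.
Implicit Types (tau z w : R[i]).

Definition cexp z : R[i] :=
  (expR (complex.Re z))%:C * (cos (complex.Im z) +i* sin (complex.Im z)).

Definition nome tau : R[i] := cexp (2 * pi%:C * 'i%C * tau).

Definition lambert (k : nat) tau : R[i] :=
  \big[+%R/0]_(1 <= n <oo) (n%:R ^+ k * nome tau ^+ n / (1 - nome tau ^+ n)).

Definition E2 tau : R[i] := 1 - 24 * lambert 1 tau.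
Definition E4 tau : R[i] := 1 + 240 * lambert 3 tau.
Definition E6 tau : R[i] := 1 - 504 * lambert 5 tau.

Definition kleinJ tau : R[i] := E4 tau ^+ 3 / (E4 tau ^+ 3 - E6 tau ^+ 2).

Definition s2 tau : R[i] :=
  E4 tau / E6 tau * (E2 tau - (3 / (pi * complex.Im tau))%:C).

Definition pochhammer (x : R[i]) (n : nat) : R[i] := \prod_(k < n) (x + k%:R).

Definition hyp2F1 (a b c z : R[i]) : R[i] :=
  \big[+%R/0]_(0 <= n <oo)
    (pochhammer a n * pochhammer b n / pochhammer c n * (z ^+ n / (n`!)%:R)).

Definition fund_domain : set R[i] :=
  [set tau | [/\ 0 < complex.Im tau, `|complex.Re tau| < 1 / 2 & 1 < `|tau| ]].

(* The condition kleinJ tau != 0 is needed because 0^-1 = 0: where J vanishes, *)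
(* 1 / J has a pole, so such points do not satisfy |1 / J| < 1.                *)
Definition invJ_lt1 : set R[i] :=
  [set tau | [/\ fund_domain tau, kleinJ tau != 0 & `|1 / kleinJ tau| < 1]].

(* The closure of a component contains the cusp oo when the component meets    *)
(* every half-plane Im z > M.                                                  *)
Definition C_invJ_oo : set R[i] :=
  [set tau | invJ_lt1 tau /\
    forall M : R, exists2 z : R[i], connected_component invJ_lt1 tau z
                                  & M < complex.Im z].

Definition hypF (J : R[i]) : R[i] := hyp2F1 (1 / 12) (5 / 12) 1 (1 / J).

End Definitions.

(* Main.v *)
Require Import Defs.
From mathcomp Require Import all_boot all_order all_algebra.
From mathcomp Require Import complex ring lra.
From mathcomp Require Import all_classical all_reals all_analysis.

Set Implicit Arguments.
Unset Strict Implicit.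
Unset Printing Implicit Defensive.

Import Order.TTheory GRing.Theory Num.Theory.
Import numFieldNormedType.Exports.

Local Open Scope classical_set_scope.
Local Open Scope complex_scope.
Local Open Scope ring_scope.

(* Put u_n = q^n / (1 - q^n). The identity u_i u_j = u_(i+j) (1 + u_i + u_j) turns
   a weighted double sum of the u_i u_j into single Lambert series; with suitable
   weights this gives Ramanujan's differential equations for E2, E4, E6 with
   respect to D = q d/dq. Hence D(1/J) = (1/J) E6/E4, and the hypergeometric
   equation shows that the Wronskian W of f = F(1/J) and E4^(1/4), up to a factor,
   satisfies D(W^4 / E4^5) = 0. The image K under q of the given component is
   connected and accumulates at q = 0, where W vanishes, so W = 0 on K; then
   D(f^4 / E4) = 0, so F^4 = E4 on K. The derivative of F^2 is read off from
   W = 0 and the right hand side becomes F^2 E4 / (2 pi Im(tau) E6). The square of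
   F^2 E4 / E6 is J / (J - 1); its real part never vanishes on K and is positive
   near q = 0, so it is the quotient of the principal roots. *)

(** * Norm and convergence in R[i] *)

(** The classical identity behind this is F = E4^(1/4) near the cusp. Comparing F^4 with E4 keeps
    every function single valued in q, so no branch of a fourth root has to be followed; the price
    is that the sign of F^2 stays open and must be settled against the principal roots. At q = 0 the
    hypergeometric equation is singular, and regularity there singles out F among its solutions; for
    the Wronskian this becomes the value 0 at q = 0. The nome never takes the value 0, so constants
    are carried along K and then identified by continuity at 0. K is only known to be connected, so
    differentiation takes place in a larger open region. The quadratic irrationality enters through
    Im(tau) = sqrt d / (2a): the term 3 / (pi Im(tau)) of s2 is six times the factor a / (pi sqrt d)
    on the left, and the holomorphic terms cancel. *)

Section ComplexTopology.
Variable R : realType.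
Local Notation C := R[i].
Implicit Types (x y z w : C).

(** The norm of R[i] takes its values in R[i]; this real-valued copy lets majorants and their series
    live in R. *)
Definition cnorm z : R := ComplexField.Normc.normc z.

Lemma cnormE z : `|z| = (cnorm z)%:C.
Proof. by []. Qed.

Lemma cnorm_ge0 z : 0 <= cnorm z.
Proof. by rewrite -lecR -cnormE normr_ge0. Qed.

Lemma cnormM z w : cnorm (z * w) = cnorm z * cnorm w.
Proof. exact: ComplexField.Normc.normcM. Qed.

Lemma cnormV z : cnorm z^-1 = (cnorm z)^-1.
Proof. exact: ComplexField.Normc.normcV. Qed.

Lemma cnorm0 : cnorm 0 = 0.
Proof. exact: ComplexField.Normc.normc0. Qed.

Lemma cnorm1 : cnorm 1 = 1.
Proof. exact: ComplexField.Normc.normc1. Qed.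

Lemma cnormX z n : cnorm (z ^+ n) = cnorm z ^+ n.
Proof. by elim: n => [|n IH]; rewrite ?expr0 ?cnorm1 // !exprS cnormM IH. Qed.

Lemma cnormR (r : R) : cnorm r%:C = `|r|.
Proof. by rewrite /cnorm /= expr0n addr0 sqrtr_sqr. Qed.

Lemma cnorm_nat n : cnorm n%:R = n%:R.
Proof. by rewrite -(rmorph_nat (real_complex R)) cnormR ger0_norm. Qed.

Lemma cnormN z : cnorm (- z) = cnorm z.
Proof. by apply: complexI; rewrite -!cnormE normrN. Qed.

Lemma ler_cnormD z w : cnorm (z + w) <= cnorm z + cnorm w.
Proof. by rewrite -lecR rmorphD /= -!cnormE ler_normD. Qed.

Lemma ler_cnormB z w : cnorm (z - w) <= cnorm z + cnorm w.
Proof. by rewrite -(cnormN w) ler_cnormD. Qed.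

Lemma ler_sub_cnorm z w : cnorm z - cnorm w <= cnorm (z - w).
Proof. by rewrite lerBlDr (le_trans _ (ler_cnormD _ _)) // subrK. Qed.

Lemma cnorm_distC z w : cnorm (z - w) = cnorm (w - z).
Proof. by rewrite -cnormN opprB. Qed.

Lemma cnorm_eq0 z : (cnorm z == 0) = (z == 0).
Proof.
apply/eqP/eqP => [|->]; last exact: cnorm0.
exact: ComplexField.Normc.eq0_normc.
Qed.

Lemma cnorm_gt0 z : (0 < cnorm z) = (z != 0).
Proof. by rewrite lt_neqAle cnorm_ge0 andbT eq_sym cnorm_eq0. Qed.

Lemma ler_cnorm_sum I (r : seq I) (P : pred I) (F : I -> C) :
  cnorm (\sum_(i <- r | P i) F i) <= \sum_(i <- r | P i) cnorm (F i).
Proof.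
elim/big_ind2 : _ => // [|x1 x2 y1 y2 h1 h2]; first by rewrite cnorm0.
by rewrite (le_trans (ler_cnormD _ _)) // lerD.
Qed.

Lemma normr_Re_le z : `|complex.Re z| <= cnorm z.
Proof.
by case: z => a b /=; rewrite -[leLHS]sqrtr_sqr ler_sqrt ?lerDl ?addr_ge0 ?sqr_ge0.
Qed.

Lemma normr_Im_le z : `|complex.Im z| <= cnorm z.
Proof.
by case: z => a b /=; rewrite -[leLHS]sqrtr_sqr ler_sqrt ?lerDr ?addr_ge0 ?sqr_ge0.
Qed.

Lemma ReD z w : complex.Re (z + w) = complex.Re z + complex.Re w.
Proof. by case: z; case: w. Qed.

Lemma ImD z w : complex.Im (z + w) = complex.Im z + complex.Im w.
Proof. by case: z; case: w. Qed.

Lemma ReN z : complex.Re (- z) = - complex.Re z.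
Proof. by case: z. Qed.

Lemma ImN z : complex.Im (- z) = - complex.Im z.
Proof. by case: z. Qed.

Lemma Re_sum I (r : seq I) (P : pred I) (F : I -> C) :
  complex.Re (\sum_(i <- r | P i) F i) = \sum_(i <- r | P i) complex.Re (F i).
Proof. by apply: (big_morph _ ReD). Qed.

Lemma Im_sum I (r : seq I) (P : pred I) (F : I -> C) :
  complex.Im (\sum_(i <- r | P i) F i) = \sum_(i <- r | P i) complex.Im (F i).
Proof. by apply: (big_morph _ ImD). Qed.

Lemma cvg_cnormP (T : Type) (F : set_system T) {FF : Filter F} (f : T -> C) z :
  f @ F --> z <-> (forall e : R, 0 < e -> \forall t \near F, cnorm (f t - z) < e).
Proof.
rewrite cvgrPdist_lt; split => h e.
  rewrite -(ltcR 0) => /h; apply: filterS => t.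
  by rewrite -normrN opprB cnormE ltcR.
(* A positive element of R[i] has imaginary part 0, so real radii suffice. *)
rewrite ltcE /= => /andP[/eqP ei0 er0].
have -> : e = (complex.Re e)%:C by case: e ei0 {er0} => a b /= ->.
move/h: er0; apply: filterS => t.
by rewrite -normrN opprB cnormE ltcR.
Qed.

Lemma cvg_cnorm_le (T : Type) (F : set_system T) {FF : Filter F}
    (f : T -> C) z (g : T -> R) :
  (\forall t \near F, cnorm (f t - z) <= g t) -> g @ F --> 0 -> f @ F --> z.
Proof.
move=> fg /cvgrPdist_lt g0; apply/cvg_cnormP => e /g0.
apply: filterS2 fg => t h; rewrite sub0r normrN; apply: le_lt_trans.
exact: le_trans h (ler_norm _).
Qed.

Lemma cvg_Re (T : Type) (F : set_system T) {FF : Filter F} (f : T -> C) z :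
  f @ F --> z -> (fun t => complex.Re (f t)) @ F --> complex.Re z.
Proof.
move=> /cvg_cnormP h; apply/cvgrPdist_lt => e /h; apply: filterS => t.
by apply: le_lt_trans; rewrite -ReN -ReD (le_trans (normr_Re_le _)) // cnorm_distC.
Qed.

Lemma cvg_Im (T : Type) (F : set_system T) {FF : Filter F} (f : T -> C) z :
  f @ F --> z -> (fun t => complex.Im (f t)) @ F --> complex.Im z.
Proof.
move=> /cvg_cnormP h; apply/cvgrPdist_lt => e /h; apply: filterS => t.
by apply: le_lt_trans; rewrite -ImN -ImD (le_trans (normr_Im_le _)) // cnorm_distC.
Qed.

Lemma cvg_cnorm (T : Type) (F : set_system T) {FF : Filter F} (f : T -> C) z :
  f @ F --> z -> (fun t => cnorm (f t)) @ F --> cnorm z.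
Proof.
move=> /cvg_cnormP h; apply/cvgrPdist_lt => e /h; apply: filterS => t.
apply: le_lt_trans; rewrite ler_norml lerNl opprB ler_sub_cnorm.
by rewrite cnorm_distC ler_sub_cnorm.
Qed.

Lemma cnorm_le_ReIm z : cnorm z <= `|complex.Re z| + `|complex.Im z|.
Proof.
case: z => a b; have -> : a +i* b = a%:C + 'i * b%:C by simpc.
rewrite (le_trans (ler_cnormD _ _)) // cnormM !cnormR.
by rewrite [X in X * _]/cnorm /= expr0n expr1n add0r sqrtr1 mul1r; simpc.
Qed.

Lemma cvg_ReIm (T : Type) (F : set_system T) {FF : Filter F} (f : T -> C) z :
  (fun t => complex.Re (f t)) @ F --> complex.Re z ->
  (fun t => complex.Im (f t)) @ F --> complex.Im z -> f @ F --> z.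
Proof.
move=> /cvgrPdist_lt hr /cvgrPdist_lt hi; apply/cvg_cnormP => e e0.
have e2 : 0 < e / 2 by rewrite divr_gt0.
apply: filterS2 (hr _ e2) (hi _ e2) => t h1 h2.
rewrite cnorm_distC (le_lt_trans (cnorm_le_ReIm _)) //.
by rewrite ReD ImD ReN ImN [e]splitr ltrD.
Qed.

End ComplexTopology.

(** * Continuity, series and complex derivatives *)

Section ComplexContinuity.
Variable R : realType.
Local Notation C := R[i].
Implicit Types (z w : C) (f g : C -> C).

Lemma nearS z (P Q : C -> Prop) : (forall w, P w -> Q w) ->
  (\forall w \near z, P w) -> \forall w \near z, Q w.
Proof. by move=> PQ; exact: (@filterS _ (nbhs z)). Qed.

Lemma nearS2 z (P Q S : C -> Prop) : (forall w, P w -> Q w -> S w) ->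
  (\forall w \near z, P w) -> (\forall w \near z, Q w) ->
  \forall w \near z, S w.
Proof. by move=> PQS; exact: (@filterS2 _ (nbhs z)). Qed.

Lemma near_all z (P : C -> Prop) : (forall w, P w) -> \forall w \near z, P w.
Proof. by move=> p; exact: (@nearW _ (nbhs z)). Qed.

(* Sealed: otherwise unification unfolds the neighbourhood filter of R[i]. *)
Variant cont f z : Prop := Cont of f @ z --> f z.

Lemma contP f z : cont f z <-> f @ z --> f z.
Proof. by split=> [[]|]. Qed.

Lemma contD f g z : cont f z -> cont g z -> cont (fun w => f w + g w) z.
Proof.
move=> [cf] [cg]; have := @cvgD _ _ _ (nbhs z) _ f g _ _ cf cg.
by move=> h; split; apply: h.
Qed.

Lemma contN f z : cont f z -> cont (fun w => - f w) z.
Proof.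
move=> [cf]; have := @cvgN _ _ _ (nbhs z) _ f _ cf.
by move=> h; split; apply: h.
Qed.

Lemma contB f g z : cont f z -> cont g z -> cont (fun w => f w - g w) z.
Proof. by move=> cf cg; apply: contD => //; exact: contN. Qed.

Lemma contM f g z : cont f z -> cont g z -> cont (fun w => f w * g w) z.
Proof.
move=> [cf] [cg]; have := @cvgM _ _ (nbhs z) _ f g _ _ cf cg.
by move=> h; split; apply: h.
Qed.

Lemma contV f z : cont f z -> f z != 0 -> cont (fun w => (f w)^-1) z.
Proof.
move=> [cf] fz0; have := @cvgV _ _ (nbhs z) _ f _ fz0 cf.
by move=> h; split; apply: h.
Qed.

Lemma cont_cst (k : C) z : cont (fun=> k) z.
Proof. by split; exact: (@cvg_cst _ _ _ (nbhs z)). Qed.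

Lemma cont_id z : cont (fun w => w) z.
Proof. by split; exact: cvg_id. Qed.

Lemma cont_comp f g z : cont f z -> cont g (f z) -> cont (fun w => g (f w)) z.
Proof. by move=> [cf] [cg]; split; apply: (@cvg_comp _ _ _ f g _ _ _ cf cg). Qed.

Lemma contX f z n : cont f z -> cont (fun w => f w ^+ n) z.
Proof.
move=> cf; elim: n => [|n IH]; first exact: cont_cst.
by under eq_fun do rewrite exprS; exact: contM.
Qed.

Lemma cont_sum (I : Type) (r : seq I) (f : I -> C -> C) z :
  (forall i, cont (f i) z) -> cont (fun w => \sum_(i <- r) f i w) z.
Proof.
move=> fc; elim: r => [|i r IH].
  by under eq_fun do rewrite big_nil; exact: cont_cst.
by under eq_fun do rewrite big_cons; exact: contD.
Qed.

Lemma cont_near f z : cont f z -> forall e : R, 0 < e ->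
  \forall w \near z, cnorm (f w - f z) < e.
Proof. by move=> [/cvg_cnormP]. Qed.

Lemma near_cont f z :
  (forall e : R, 0 < e -> \forall w \near z, cnorm (f w - f z) < e) -> cont f z.
Proof. by move=> h; split; apply/(@cvg_cnormP _ _ (nbhs z) _). Qed.

Lemma cont_neq0 f z : cont f z -> f z != 0 -> \forall w \near z, f w != 0.
Proof.
move=> fc; rewrite -cnorm_gt0 => /(cont_near fc).
apply: nearS => w; apply: contraTneq => ->.
by rewrite sub0r cnormN ltxx.
Qed.

Lemma near_cnormP z (P : C -> Prop) :
  (\forall w \near z, P w) <->
  (exists2 e : R, 0 < e & forall w, cnorm (w - z) < e -> P w).
Proof.
split=> [/nbhs_ballP [e]|[e e0 h]].
  rewrite /= ltcE => /= /andP[/eqP ei er] h.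
  exists (complex.Re e) => // w wz; apply: h; rewrite /ball /= cnormE.
  have -> : e = (complex.Re e)%:C by case: e ei {er wz} => a b /= ->.
  by rewrite ltcR cnorm_distC.
apply: nearS h _; apply: cont_near e0; exact: cont_id.
Qed.

End ComplexContinuity.

(** * Complex series with a convergent majorant *)

Section ComplexSeries.
Variable R : realType.
Local Notation C := R[i].
Implicit Types (x y z w : C) (a b : nat -> C) (M : nat -> R).

Definition csum a : C := limn (series a).

Lemma csum_unique a z : series a @ \oo --> z -> csum a = z.
Proof. exact: cvg_lim. Qed.

(** Comparison is applied to the real and imaginary parts, which reduces the claim to absolute
    convergence in R. *)
Lemma csum_cvg a M : (forall n, cnorm (a n) <= M n) -> cvgn (series M) ->
  series a @ \oo --> csum a.
Proof.
move=> aM cM.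
have cre : cvgn (series (fun n => complex.Re (a n))).
  apply: normed_cvg; apply: series_le_cvg cM => n //=.
  - by rewrite (le_trans _ (aM n)) // cnorm_ge0.
  - by rewrite (le_trans _ (aM n)) // normr_Re_le.
have cim : cvgn (series (fun n => complex.Im (a n))).
  apply: normed_cvg; apply: series_le_cvg cM => n //=.
  - by rewrite (le_trans _ (aM n)) // cnorm_ge0.
  - by rewrite (le_trans _ (aM n)) // normr_Im_le.
have cv : series a @ \oo --> limn (series (fun n => complex.Re (a n)))
   +i* limn (series (fun n => complex.Im (a n))).
  apply: cvg_ReIm => /=.
    under eq_fun do rewrite /series/= Re_sum.
    exact: cre.
  under eq_fun do rewrite /series/= Im_sum.
  exact: cim.
by rewrite (csum_unique cv).
Qed.

Lemma csum_tail a M N : (forall n, cnorm (a n) <= M n) -> cvgn (series M) ->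
  cnorm (csum a - series a N) <= limn (series M) - series M N.
Proof.
move=> aM cM.
have c1 : (fun n => cnorm (series a n - series a N)) @ \oo -->
    cnorm (csum a - series a N).
  apply: cvg_cnorm; apply: cvgB (cvg_cst _); exact: csum_cvg cM.
have c2 : (fun n => series M n - series M N) @ \oo -->
    limn (series M) - series M N.
  exact: cvgB cM (cvg_cst _).
rewrite -(cvg_lim _ c1) // -(cvg_lim _ c2) //.
apply: ler_lim; [exact: cvgP c1|exact: cvgP c2|].
near=> n; have Nn : (N <= n)%N by near: n; exact: nbhs_infty_ge.
rewrite !sub_series_geq // (le_trans (ler_cnorm_sum _ _ _)) //.
exact: ler_sum.
Unshelve. all: by end_near. Qed.

Lemma csumD a b M M' : (forall n, cnorm (a n) <= M n) -> cvgn (series M) ->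
  (forall n, cnorm (b n) <= M' n) -> cvgn (series M') ->
  csum (fun n => a n + b n) = csum a + csum b.
Proof.
move=> aM cM bM cM'; apply: csum_unique.
rewrite (_ : series _ = series a + series b); last by rewrite seriesD.
by apply: cvgD; [exact: csum_cvg cM|exact: csum_cvg cM'].
Qed.

Lemma csumZ a M z : (forall n, cnorm (a n) <= M n) -> cvgn (series M) ->
  csum (fun n => z * a n) = z * csum a.
Proof.
move=> aM cM; apply: csum_unique.
rewrite (_ : series _ = (fun n => z * series a n)).
  by apply: cvgM (cvg_cst _) _; exact: csum_cvg cM.
by apply/funext => n; rewrite /series /= mulr_sumr.
Qed.

Lemma csum_recl a M : (forall n, cnorm (a n) <= M n) -> cvgn (series M) ->
  csum a = a 0%N + csum (fun n => a n.+1).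
Proof.
move=> aM cM; apply/eqP; rewrite addrC -subr_eq; apply/eqP; apply/esym.
apply: csum_unique.
have -> : series (fun n => a n.+1) = (fun n => series a n.+1 - a 0%N).
  by apply/funext => n; rewrite /series /= big_nat_recl// addrAC subrr add0r.
apply: cvgB (cvg_cst _).
by have := csum_cvg aM cM; rewrite -cvg_shiftS.
Qed.

(** The Weierstrass M-test: [csum_tail] bounds the remainder uniformly in w, so a finite sum carries
    the continuity. *)
Lemma csum_continuous (psi : nat -> C -> C) M z :
  (\forall w \near z, forall n, cnorm (psi n w) <= M n) -> cvgn (series M) ->
  (forall n, cont (psi n) z) ->
  cont (fun w => csum (psi^~ w)) z.
Proof.
move=> pM cM pc; apply: near_cont => e e0.
have e3 : 0 < e / 3 by rewrite divr_gt0.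
have [N hN] : exists N, limn (series M) - series M N < e / 3.
  have /cvgrPdist_lt/(_ _ e3) [N _ /(_ N (leqnn N)) h] := cM.
  by exists N; rewrite (le_lt_trans (ler_norm _) h).
have pMz := nbhs_singleton pM.
have cN : cont (fun w => series (psi^~ w) N) z by exact: cont_sum.
have {}cN := cont_near cN e3.
near=> w.
have -> : csum (psi^~ w) - csum (psi^~ z) =
  (csum (psi^~ w) - series (psi^~ w) N) +
  (series (psi^~ w) N - series (psi^~ z) N) -
  (csum (psi^~ z) - series (psi^~ z) N) by ring.
rewrite (le_lt_trans (ler_cnormB _ _))// (_ : e = e/3 + e/3 + e/3); last by field.
apply: ltrD; last by rewrite (le_lt_trans _ hN) ?csum_tail.
rewrite (le_lt_trans (ler_cnormD _ _))//; apply: ltrD.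
  by rewrite (le_lt_trans _ hN) ?csum_tail //; near: w.
by near: w.
Unshelve. all: by end_near. Qed.

End ComplexSeries.

(** * Calculus of complex derivatives *)

Section ComplexDerivative.
Variable R : realType.
Local Notation C := R[i].
Implicit Types (x y z w : C) (f g : C -> C).

(* Caratheodory's form of the complex derivative. *)
Definition cder f z (l : C) := exists2 psi : C -> C,
  cont psi z /\ psi z = l
  & \forall w \near z, f w = f z + (w - z) * psi w.

Lemma cder_continuous f z l : cder f z l -> cont f z.
Proof.
move=> [psi [pc pl] h].
have c : cont (fun w => f z + (w - z) * psi w) z.
  apply/contD/contM => //; first exact: cont_cst.
  by apply/contB/cont_cst; exact: cont_id.
apply: near_cont => e /(cont_near c); apply: nearS2 h => w ->.
by rewrite subrr mul0r addr0.
Qed.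

Lemma cder_cst k z : cder (cst k) z 0.
Proof.
exists (cst 0); first by split=> //; exact: cont_cst.
by apply: near_all => w; rewrite mulr0 addr0.
Qed.

Lemma cder_id z : cder id z 1.
Proof.
exists (cst 1); first by split=> //; exact: cont_cst.
by apply: near_all => w; rewrite mulr1 addrC subrK.
Qed.

Lemma cderD f g z l m : cder f z l -> cder g z m ->
  cder (fun w => f w + g w) z (l + m).
Proof.
move=> [p [pc <-] pf] [r [rc <-] rg].
exists (fun w => p w + r w); first by split=> //; apply: contD.
by apply: nearS2 pf rg => w -> ->; ring.
Qed.

Lemma cderM f g z l m : cder f z l -> cder g z m ->
  cder (fun w => f w * g w) z (l * g z + f z * m).
Proof.
move=> df dg; have gc := cder_continuous dg.
case: df dg => [p [pc <-] pf] [r [rc <-] rg].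
exists (fun w => p w * g w + f z * r w).
  by split=> //; apply: contD; apply: contM => //; exact: cont_cst.
by apply: nearS2 pf rg => w -> ->; ring.
Qed.

Lemma cderZ f z l k : cder f z l -> cder (fun w => k * f w) z (k * l).
Proof.
by move=> /(cderM (cder_cst k z)); rewrite mul0r add0r.
Qed.

Lemma cderN f z l : cder f z l -> cder (fun w => - f w) z (- l).
Proof.
by move=> /(cderZ (-1)); under eq_fun do rewrite mulN1r; rewrite mulN1r.
Qed.

Lemma cderB f g z l m : cder f z l -> cder g z m ->
  cder (fun w => f w - g w) z (l - m).
Proof. by move=> df /cderN; exact: cderD. Qed.

Lemma cderX f z l n : cder f z l ->
  cder (fun w => f w ^+ n) z (n%:R * f z ^+ n.-1 * l).
Proof.
move=> df; elim: n => [|n IH].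
  by rewrite mul0r mul0r; under eq_fun do rewrite expr0; exact: cder_cst.
under eq_fun do rewrite exprS.
have := cderM df IH; congr (cder _ _ _).
case: n {IH} => [|n] /=; first by rewrite !expr0; ring.
rewrite -[in n.+2%:R]addn1 natrD exprS; ring.
Qed.

Lemma cderV f z l : cder f z l -> f z != 0 ->
  cder (fun w => (f w)^-1) z (- l / f z ^+ 2).
Proof.
move=> df fz0; have fc := cder_continuous df; case: df => [p [pc <-] pf].
have fw0 := cont_neq0 fc fz0.
exists (fun w => - p w / (f w * f z)).
  split=> //; apply: contM; first exact: contN.
  by apply: contV; [apply: contM => //; exact: cont_cst|rewrite mulf_neq0].
apply: nearS2 pf fw0 => w e fw.
have -> : (w - z) * (- p w / (f w * f z)) = (f z - f w) / (f w * f z).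
  by rewrite (_ : f z - f w = - ((w - z) * p w)) ?mulrN ?mulNr ?mulrA // e; ring.
by field; rewrite fw fz0.
Qed.

Lemma cder_comp f g z l m : cder f z l -> cder g (f z) m ->
  cder (fun w => g (f w)) z (m * l).
Proof.
move=> df; have fc := cder_continuous df; case: df => [p [pc <-] pf].
move=> [r [rc <-] rg].
exists (fun w => r (f w) * p w).
  by split=> //; apply: contM => //; exact: cont_comp.
have /contP /(_ _ rg) /= rg' := fc.
apply: nearS2 pf rg' => w e ->.
by rewrite (_ : f w - f z = (w - z) * p w); [ring|rewrite e; ring].
Qed.

(** In Caratheodory's form, termwise differentiation is the M-test for the slopes [psi n]: their sum
    is the slope of the sum, and it is continuous at z. *)
Lemma cder_csum (F psi : nat -> C -> C) (M N : nat -> R) z :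
  (\forall w \near z, forall n, F n w = F n z + (w - z) * psi n w) ->
  (forall n, cont (psi n) z) ->
  (\forall w \near z, forall n, cnorm (psi n w) <= M n) -> cvgn (series M) ->
  (forall n, cnorm (F n z) <= N n) -> cvgn (series N) ->
  cder (fun w => csum (F^~ w)) z (csum (psi^~ z)).
Proof.
move=> Fp pc pM cM FN cN.
exists (fun w => csum (psi^~ w)); first by split=> //; exact: csum_continuous cM _.
apply: nearS2 Fp pM => w h1 h2.
rewrite -(csumZ (w - z) h2 cM) -(csumD FN cN (M' := fun n => cnorm (w - z) * M n)).
- by congr csum; apply/funext => n.
- by move=> n; rewrite cnormM ler_wpM2l ?cnorm_ge0.
- exact: is_cvg_seriesZ.
Qed.

Lemma cder_derive1 f z l : cder f z l -> derive1 f z = l.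
Proof.
move=> [p [pc <-] pf]; rewrite /derive1; apply: cvg_lim => //.
have sh (P : C -> Prop) : (\forall w \near z, P w) ->
    \forall h \near (0 : C), P (h + z).
  move=> /near_cnormP [e e0 h]; apply/near_cnormP; exists e => // w we.
  by apply: h; rewrite addrK -[w]subr0.
have c : (fun h => p (h + z)) @ (0 : C)^' --> p z.
  apply/cvg_cnormP => e e0; rewrite /dnbhs near_withinE.
  by apply: nearS (sh _ (cont_near pc e0)).
apply: cvg_trans c; apply: (@near_eq_cvg _ _ (0 : C)^').
rewrite /dnbhs near_withinE; apply: nearS (sh _ pf) => h -> h0.
rewrite addrAC subrr add0r addrK.
by change (p (h + z) = h^-1 * (h * p (h + z))); rewrite mulrA mulVf // mul1r.
Qed.

End ComplexDerivative.

(** * Locally constant functions *)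

Section LocallyConstant.
Variable R : realType.
Local Notation C := R[i].
Implicit Types (z w : C) (f : C -> C).

Let line (z w : C) (s : R) : C := z + s%:C * (w - z).

Let cvg_line z w s : line z w @ s --> line z w s.
Proof.
apply/cvg_cnormP => e e0.
have e1 : 0 < e / (cnorm (w - z) + 1).
  by rewrite divr_gt0 // ltr_wpDl // cnorm_ge0.
have : \forall t \near s, `|s - t| < e / (cnorm (w - z) + 1).
  by apply/nbhs_ballP; exists (e / (cnorm (w - z) + 1)).
apply: filterS => t st.
have -> : line z w t - line z w s = (t - s)%:C * (w - z).
  by rewrite /line rmorphB /=; ring.
rewrite cnormM cnormR distrC.
have n1 : 0 < cnorm (w - z) + 1 by rewrite ltr_wpDl // cnorm_ge0.
rewrite (le_lt_trans (y := `|s - t| * (cnorm (w - z) + 1))) //.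
  by rewrite ler_wpM2l // lerDl.
by rewrite -ltr_pdivlMr.
Qed.

Let cvg_line_shift z w s :
  (fun h : R => line z w (h + s)) @ (0 : R) --> line z w s.
Proof.
have c : (fun h : R => h + s) @ (0 : R) --> s.
  have : (fun h : R => h + s) @ (0 : R) --> 0 + s.
    by apply: cvgD (cvg_cst _); exact: cvg_id.
  by rewrite add0r.
exact: (@cvg_comp _ _ _ (fun h : R => h + s) (line z w) _ _ _ c (@cvg_line z w s)).
Qed.

(* L stands for Re or Im. *)
Lemma is_derive_line (L : C -> R) f z w (s : R) :
  (forall x y, L (x + y) = L x + L y) ->
  (forall (r : R) x, L (r%:C * x) = r * L x) ->
  (forall (T : Type) (F : set_system T) (FF : Filter F) (g : T -> C) y,
     g @ F --> y -> (L \o g) @ F --> L y) ->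
  cder f (line z w s) 0 -> is_derive s 1 (fun t => L (f (line z w t))) (0 : R).
Proof.
move=> LD LZ Lc [psi [pc p0] pf].
have L0 : L 0 = 0 by rewrite -(mul0r 0) -[X in X * 0]/((0:R)%:C) LZ mul0r.
set g := fun t => L (f (line z w t)).
have cl : (fun h : R => psi (line z w (h + s))) @ (0:R) --> (0 : C).
  case: pc => pc; rewrite -p0.
  exact: (@cvg_comp _ _ _ (fun h : R => line z w (h + s)) psi _ _ _
    (@cvg_line_shift z w s) pc).
have pf' : \forall h \near (0:R), f (line z w (h + s)) =
    f (line z w s) + (line z w (h + s) - line z w s) * psi (line z w (h + s)).
  exact: cvg_line_shift pf.
have cv : (fun h : R => h^-1 *: ((g \o shift s) (h *: 1) - g s)) @ 0^' --> (0:R).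
  have c : (fun h : R => L ((w - z) * psi (line z w (h + s)))) @ 0^' --> (0:R).
    have := Lc _ (0 : R)^' _ (fun h => (w - z) * psi (line z w (h + s)))
      ((w - z) * 0).
    rewrite mulr0 L0; apply; rewrite -[X in _ --> X](mulr0 (w - z)).
    apply: (@cvgM _ _ (0 : R)^'); first exact: (@cvg_cst _ _ _ (0 : R)^').
    exact: (@cvg_within_filter _ _ _ (nbhs (0 : R))) cl.
  apply: cvg_trans c; apply: near_eq_cvg.
  rewrite /dnbhs near_withinE; apply: filterS pf' => h e h0.
  rewrite /= /g [_ *: 1]mulr1 e LD addrAC subrr add0r.
  have -> : line z w (h + s) - line z w s = h%:C * (w - z).
    by rewrite /line rmorphD /=; ring.
  by rewrite -mulrA LZ; rewrite -[RHS]/(h^-1 * (h * _)) mulKf.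
by apply: DeriveDef; [exact: cvgP cv|exact: cvg_lim cv].
Qed.

(** The mean value theorem holds for real-valued functions only, hence the passage through L along
    the segment from z to w. *)
Lemma line_cst (L : C -> R) f z w :
  (forall x y, L (x + y) = L x + L y) ->
  (forall (r : R) x, L (r%:C * x) = r * L x) ->
  (forall (T : Type) (F : set_system T) (FF : Filter F) (g : T -> C) y,
     g @ F --> y -> (L \o g) @ F --> L y) ->
  (forall s : R, 0 <= s <= 1 -> cder f (line z w s) 0) -> L (f w) = L (f z).
Proof.
move=> LD LZ Lc fd.
have fd' s (h : 0 <= s <= 1) := is_derive_line LD LZ Lc (fd s h).
have := @MVT_segment R (fun t => L (f (line z w t))) (cst 0) 0 1 ler01.
case=> [s|| s _].
- by rewrite in_itv /= => /andP[h1 h2]; apply: fd'; rewrite !ltW.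
- apply: derivable_within_continuous => s; rewrite in_itv /= => h.
  exact: (@ex_derive _ _ _ _ _ _ _ (fd' s h)).
rewrite mul0r => /eqP; rewrite subr_eq0 /line => /eqP.
by rewrite mul0r addr0 mul1r addrC subrK.
Qed.

Lemma near_cst_of_cder0 f (V : set C) : open V ->
  (forall z, V z -> cder f z 0) ->
  forall z, V z -> \forall w \near z, f w = f z.
Proof.
move=> oV fd z Vz.
have /near_cnormP [e e0 eV] : \forall w \near z, V w by exact: open_nbhs_nbhs.
apply/near_cnormP; exists e => // w wz.
have fd' (s : R) : 0 <= s <= 1 -> cder f (line z w s) 0.
  move=> /andP[s0 s1]; apply/fd/eV; rewrite /line addrAC subrr add0r.
  by rewrite cnormM cnormR ger0_norm // (le_lt_trans _ wz) // ler_piMl ?cnorm_ge0.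
apply/eqP; rewrite eq_complex; apply/andP; split; apply/eqP.
  apply: line_cst fd' => [x y|r [a b]|T F FF g y].
  - exact: ReD.
  - by simpc.
  - exact: cvg_Re.
apply: line_cst fd' => [x y|r [a b]|T F FF g y].
- exact: ImD.
- by simpc.
- exact: cvg_Im.
Qed.

(** [U P] is open in the plane and meets K exactly where f satisfies P. With P and its negation, the
    level set of [f x] in K is both relatively open and relatively closed. *)
Lemma connected_locally_cst (T : Type) (f : C -> T) (K : set C) :
  connected K -> (forall z, K z -> \forall w \near z, f w = f z) ->
  forall x y, K x -> K y -> f x = f y.
Proof.
move=> cK fK x y Kx Ky.
pose U (P : T -> Prop) : set C := interior [set w | K w -> P (f w)].
have UP (P : T -> Prop) w : K w -> U P w -> P (f w).
  by move=> Kw /nbhs_singleton; apply.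
have PU (P : T -> Prop) w : K w -> P (f w) -> U P w.
  move=> Kw Pw; rewrite /U /interior /=.
  by apply: nearS (fK _ Kw) => v /= -> _.
suff HK : K `&` U (fun t => t = f x) = K.
  by have := Ky; rewrite -{1}HK => -[/UP h /h ->].
apply: cK.
- by exists x; split=> //; exact: PU.
- by exists (U (fun t => t = f x)) => //; exact: open_interior.
exists (~` U (fun t => t <> f x)); first by apply: open_closedC; exact: open_interior.
apply/seteqP; split=> w [Kw Uw]; split=> //.
  by move=> Uw'; exact: (UP _ _ Kw Uw') (UP _ _ Kw Uw).
by apply: (PU _ _ Kw); apply: contrapT => ne; apply: Uw; exact: PU.
Qed.

End LocallyConstant.

(** * Elementary estimates and finite sums *)

Section PowerGeometric.
Variable R : realType.
Implicit Types (r : R).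

Lemma bernoulli_ineq (h : R) n : 0 <= h -> 1 + n%:R * h <= (1 + h) ^+ n.
Proof.
move=> h0; elim: n => [|n IH]; first by rewrite mul0r addr0 expr0.
rewrite exprS (le_trans (y := (1 + h) * (1 + n%:R * h))) //.
  have : 0 <= n%:R * h * h by rewrite !mulr_ge0.
  by rewrite -natr1; lra.
by rewrite ler_wpM2l // addr_ge0.
Qed.

(** Induction on k with r = s * s: one factor s^n absorbs a power of n by Bernoulli's inequality for
    1/s = 1 + h, the other goes to the induction hypothesis at s. *)
Lemma pow_geo_bounded k r : 0 < r < 1 ->
  exists2 B, 0 <= B & forall n, n.+1%:R ^+ k * r ^+ n <= B.
Proof.
elim: k r => [|k IH] r /andP[r0 r1].
  by exists 1 => // n; rewrite mul1r exprn_ile1 // ltW.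
have s0 : 0 < Num.sqrt r by rewrite sqrtr_gt0.
have s1 : Num.sqrt r < 1 by rewrite -sqrtr1 ltr_sqrt.
have [|B B0 hB] := IH (Num.sqrt r); first by rewrite s0 s1.
have rE : r = Num.sqrt r * Num.sqrt r by rewrite -expr2 sqr_sqrtr // ltW.
set s := Num.sqrt r in s0 s1 hB rE *.
pose h := s^-1 - 1.
have h0 : 0 < h by rewrite subr_gt0 invf_gt1.
have hs : s = (1 + h)^-1 by rewrite /h addrC subrK invrK.
clearbody h.
have hn n : n.+1%:R * s ^+ n <= 1 + h^-1.
  rewrite hs exprVn ler_pdivrMr ?exprn_gt0 ?addr_gt0 //.
  rewrite (le_trans (y := (1 + h^-1) * (1 + n%:R * h))) //; last first.
    by rewrite ler_wpM2l ?bernoulli_ineq ?ltW // addr_gt0 // invr_gt0.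
  rewrite -natr1 (_ : _ * _ = n%:R + 1 + n%:R * h + h^-1).
    2: by field; rewrite gt_eqF.
  have : 0 <= n%:R * h by rewrite mulr_ge0 // ltW.
  have : 0 <= h^-1 by rewrite invr_ge0 ltW.
  lra.
exists ((1 + h^-1) * B).
  by rewrite mulr_ge0 // addr_ge0 // invr_ge0 ltW.
move=> n; have -> : n.+1%:R ^+ k.+1 * r ^+ n =
    (n.+1%:R * s ^+ n) * (n.+1%:R ^+ k * s ^+ n).
  by rewrite rE exprMn exprS; ring.
by apply: ler_pM; rewrite ?mulr_ge0 ?exprn_ge0 // ltW.
Qed.

(** Again r = s * s: n^k s^n is bounded, and the remaining s^n is a convergent geometric series. *)
Lemma is_cvg_pow_geo k r : 0 < r < 1 ->
  cvgn (series (fun n => n.+1%:R ^+ k * r ^+ n)).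
Proof.
move=> /andP[r0 r1].
have s0 : 0 < Num.sqrt r by rewrite sqrtr_gt0.
have s1 : Num.sqrt r < 1 by rewrite -sqrtr1 ltr_sqrt.
have [|B B0 hB] := @pow_geo_bounded k (Num.sqrt r); first by rewrite s0 s1.
apply: (@series_le_cvg _ _ (geometric B (Num.sqrt r))) => [n|n|n|] /=.
- by rewrite mulr_ge0 // ?exprn_ge0 // ltW.
- by rewrite mulr_ge0 // exprn_ge0 // ltW.
- rewrite -{1}(sqr_sqrtr (ltW r0)) exprAC expr2 mulrA.
  by rewrite ler_wpM2r // exprn_ge0 // ltW.
by apply: is_cvg_geometric_series; rewrite ger0_norm // ltW.
Qed.

End PowerGeometric.

Lemma expf_div_eq0 (F : fieldType) (x y : F) m n :
  y != 0 -> x ^+ m / y ^+ n = 0 -> x = 0.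
Proof.
move=> y0 /eqP; rewrite mulf_eq0 invr_eq0 !expf_eq0 (negPf y0) andbF orbF.
by move=> /andP[_ /eqP].
Qed.

Section FiniteSums.
Variable V : zmodType.

(** The square is cut into the L-shaped shells max(i, j) = m. *)
Lemma sum_square (f : nat -> nat -> V) N :
  \sum_(i < N) \sum_(j < N) f i j =
  \sum_(m < N) (\sum_(i < m) (f m i + f i m) + f m m).
Proof.
elim: N => [|N IH]; first by rewrite !big_ord0.
rewrite [RHS]big_ord_recr -IH big_ord_recr /=.
under eq_bigr do rewrite big_ord_recr.
by rewrite big_split /= big_ord_recr big_split /= -!addrA; congr (_ + _);
   rewrite addrCA.
Qed.

Lemma sum_triangle (f : nat -> nat -> V) N :
  \sum_(m < N) \sum_(i < m.+1) f i (m - i)%N =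
  \sum_(i < N) \sum_(j < N - i) f i j.
Proof.
elim: N => [|N IH]; first by rewrite !big_ord0.
rewrite big_ord_recr IH [RHS]big_ord_recr /= subSnn big_ord1.
rewrite big_ord_recr /= subnn addrA; congr (_ + _).
rewrite -big_split; apply: eq_bigr => i _.
by rewrite subSn ?big_ord_recr //= ltnW.
Qed.

(** Antidiagonals fill only the triangle i + j < N; the corner left over is the truncation error of
    the double series. *)
Lemma sum_square_triangle (f : nat -> nat -> V) N :
  \sum_(i < N) \sum_(j < N) f i j -
  \sum_(m < N) \sum_(i < m.+1) f i (m - i)%N =
  \sum_(i < N) \sum_(j < N | (N <= i + j)%N) f i j.
Proof.
rewrite sum_triangle -sumrB; apply: eq_bigr => i _.
rewrite (bigID (fun j : 'I_N => (N <= i + j)%N)) /=.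
suff -> : \sum_(j < N | ~~ (N <= i + j)%N) f i j = \sum_(j < N - i) f i j.
  by rewrite addrK.
rewrite (big_ord_widen _ (f i) (leq_subr i N)).
by apply: eq_bigl => j; rewrite -ltnNge ltn_subRL.
Qed.

End FiniteSums.

(** * Lambert series *)

Section Lambert.
Variable R : realType.
Local Notation C := R[i].
Implicit Types (q w z : C).

(* The term of index 0 is 1 / 0 = 0. *)
Definition geo q n : C := q ^+ n / (1 - q ^+ n).

Definition lam k q : C := csum (fun n => n%:R ^+ k * geo q n).

(** This is D = q d/dq applied termwise to [lam k], since D u_n = n (u_n^2 + u_n). *)
Definition dlam k q : C :=
  csum (fun n => n%:R ^+ k.+1 * (geo q n ^+ 2 + geo q n)).

Lemma geo0n q : geo q 0 = 0.
Proof. by rewrite /geo expr0 subrr invr0 mulr0. Qed.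

Lemma geo_q0 n : geo 0 n = 0.
Proof. by case: n => [|n]; rewrite ?geo0n // /geo expr0n /= mul0r. Qed.

Lemma cnorm_onemX q r n : cnorm q <= r -> r < 1 -> 1 - r <= cnorm (1 - q ^+ n.+1).
Proof.
move=> qr r1; rewrite (le_trans _ (ler_sub_cnorm _ _)) // cnorm1 lerB //.
rewrite cnormX exprS (le_trans _ qr) // ler_piMr ?cnorm_ge0 //.
by rewrite exprn_ile1 ?cnorm_ge0 // (le_trans qr) // ltW.
Qed.

Lemma onemX_neq0 q n : cnorm q < 1 -> 1 - q ^+ n.+1 != 0.
Proof.
move=> q1; rewrite -cnorm_gt0 (lt_le_trans _ (cnorm_onemX n (lexx _) q1)) //.
by rewrite subr_gt0.
Qed.

Lemma cnorm_geo q r n : cnorm q <= r -> r < 1 ->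
  cnorm (geo q n) <= r ^+ n / (1 - r).
Proof.
move=> qr r1; have r0 := le_trans (cnorm_ge0 q) qr.
have r2 : 0 < 1 - r by rewrite subr_gt0.
case: n => [|n]; first by rewrite geo0n cnorm0 divr_ge0 // ltW.
rewrite cnormM cnormX cnormV; apply: ler_pM.
- by rewrite exprn_ge0 // cnorm_ge0.
- by rewrite invr_ge0 cnorm_ge0.
- by apply: lerXn2r => //; rewrite nnegrE cnorm_ge0.
by rewrite lef_pV2 ?posrE // ?cnorm_onemX // (lt_le_trans r2) ?cnorm_onemX.
Qed.

(** The successors matter: with the default value u_0 = 0 the identity fails at index 0. *)
Lemma geoM q i j : cnorm q < 1 ->
  geo q i.+1 * geo q j.+1 =
  geo q (i.+1 + j.+1) * (1 + geo q i.+1 + geo q j.+1).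
Proof.
move=> q1; have := onemX_neq0 (i + j.+1) q1; rewrite -addSn exprD => h.
rewrite /geo exprD; field.
by rewrite h !onemX_neq0.
Qed.

Lemma between_lt1 q : cnorm q < 1 -> exists2 r : R, cnorm q < r & 0 < r < 1.
Proof.
move=> q1; have q0 := cnorm_ge0 q.
by exists ((cnorm q + 1) / 2); [lra|apply/andP; split; lra].
Qed.

Lemma cnorm_lam_term k q r n : cnorm q <= r -> r < 1 ->
  cnorm (n%:R ^+ k * geo q n) <= (1 - r)^-1 * (n.+1%:R ^+ k * r ^+ n).
Proof.
move=> qr r1; have r0 := le_trans (cnorm_ge0 q) qr.
rewrite cnormM cnormX cnorm_nat mulrCA [(1 - r)^-1 * _]mulrC.
apply: ler_pM; rewrite ?exprn_ge0 ?cnorm_ge0 //.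
  by apply: lerXn2r; rewrite ?nnegrE // ler_nat.
by rewrite cnorm_geo.
Qed.

Lemma lam_cvg k q : cnorm q < 1 ->
  series (fun n => n%:R ^+ k * geo q n) @ \oo --> lam k q.
Proof.
move=> /between_lt1 [r /ltW qr r01].
apply: (@csum_cvg _ _ (fun n => (1 - r)^-1 * (n.+1%:R ^+ k * r ^+ n))).
  by move=> n; apply: cnorm_lam_term => //; case/andP: r01.
by apply: is_cvg_seriesZ; exact: is_cvg_pow_geo.
Qed.

Lemma lam_q0 k : lam k 0 = 0.
Proof.
apply: csum_unique; have -> : (fun n => n%:R ^+ k * geo 0 n) = cst (0 : C).
  by apply/funext => n; rewrite geo_q0 mulr0.
have -> : series (cst (0 : C)) = cst 0.
  by apply/funext => n; rewrite /series /= big1.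
exact: cvg_cst.
Qed.

Lemma lambert_lam k tau : lambert k tau = lam k (nome tau).
Proof.
rewrite /lambert /lam /csum; congr (lim (_ @ \oo)); apply/funext => n.
rewrite /series /=; case: n => [|n]; first by rewrite !big_geq.
rewrite [RHS]big_nat_recl //= geo0n mulr0 add0r big_add1 /=.
by apply: eq_bigr => i _; rewrite /geo mulrA.
Qed.

Lemma cnorm_sum_XX w z (r : R) n : cnorm w <= r -> cnorm z <= r ->
  cnorm (\sum_(i < n.+1) w ^+ (n - i) * z ^+ i) <= n.+1%:R * r ^+ n.
Proof.
move=> wr zr; have r0 := le_trans (cnorm_ge0 w) wr.
apply: le_trans (ler_cnorm_sum _ _ _) _.
rewrite mulr_natl -[X in _ *+ X](card_ord n.+1) -sumr_const.
apply: ler_sum => i _; rewrite cnormM !cnormX.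
have -> : r ^+ n = r ^+ (n - i) * r ^+ i by rewrite -exprD subnK // leq_ord.
apply: ler_pM; rewrite ?exprn_ge0 ?cnorm_ge0 //;
  by apply: lerXn2r; rewrite ?nnegrE ?cnorm_ge0.
Qed.

Lemma sum_XX_diag z n :
  \sum_(i < n.+1) z ^+ (n - i) * z ^+ i = n.+1%:R * z ^+ n.
Proof.
rewrite (eq_bigr (fun=> z ^+ n)); first by rewrite sumr_const card_ord mulr_natl.
by move=> i _; rewrite -exprD subnK // leq_ord.
Qed.

(** Giving q * l rather than l avoids a division by q, so that q = 0 is covered. *)
Lemma cder_lam k q : cnorm q < 1 -> exists2 l, cder (lam k) q l & q * l = dlam k q.
Proof.
move=> q1; have [r qr r01] := between_lt1 q1; have /andP[r0 r1] := r01.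
have r2 : 0 < 1 - r by rewrite subr_gt0.
(* The slope of u_n: u_n(w) - u_n(q) = (w^n - q^n) / ((1 - w^n)(1 - q^n)), with w - q divided out of
   w^n - q^n. *)
pose psi n w : C := n%:R ^+ k *
  ((\sum_(i < n) w ^+ (n.-1 - i) * q ^+ i) / ((1 - w ^+ n) * (1 - q ^+ n))).
have nq : \forall w \near q, cnorm w < r.
  have rq : 0 < r - cnorm q by rewrite subr_gt0.
  have := cont_near (cont_id q) rq; apply: nearS => w h.
  have := ler_sub_cnorm w q; lra.
have qr' := ltW qr; have r0' := ltW r0; have r2' := ltW r2.
(* The numerator of the slope has n terms of degree n - 1, whence the extra power of n and the
   factor [r^-1]. *)
pose M n := r^-1 * (1 - r) ^- 2 * (n.+1%:R ^+ k.+1 * r ^+ n).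
have psi_le w n : cnorm w < r -> cnorm (psi n w) <= M n.
  rewrite /M; move=> /ltW wr; case: n => [|n].
    rewrite /psi big_ord0 mul0r mulr0 cnorm0.
    by rewrite mulr_ge0 // mulr_ge0 ?invr_ge0 ?exprn_ge0.
  rewrite /psi cnormM cnormX cnorm_nat cnormM cnormV cnormM.
  have -> : (r^-1 * (1 - r) ^- 2) * (n.+2%:R ^+ k.+1 * r ^+ n.+1) =
     n.+2%:R ^+ k * ((n.+2%:R * r ^+ n) * ((1 - r) * (1 - r))^-1).
    by rewrite !exprS; field; rewrite !gt_eqF.
  apply: ler_pM; rewrite ?exprn_ge0 ?mulr_ge0 ?invr_ge0 ?mulr_ge0 ?cnorm_ge0 //.
    by apply: lerXn2r; rewrite ?nnegrE // ler_nat.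
  apply: ler_pM; rewrite ?invr_ge0 ?mulr_ge0 ?cnorm_ge0 //; last first.
    have hw := cnorm_onemX n wr r1; have hq := cnorm_onemX n qr' r1.
    rewrite lef_pV2 ?posrE ?mulr_gt0 // ?(lt_le_trans r2) //.
    by apply: ler_pM; rewrite // ltW.
  apply: le_trans (cnorm_sum_XX n wr qr') _.
  by rewrite ler_wpM2r ?exprn_ge0 // ler_nat.
exists (csum (psi^~ q)).
  apply: (@cder_csum _ (fun n w => n%:R ^+ k * geo w n) psi
     M
     (fun n => (1 - r)^-1 * (n.+1%:R ^+ k * r ^+ n))).
  - apply: nearS nq => w wr [|n].
      by rewrite !geo0n /psi big_ord0 mul0r !mulr0 addr0.
    have w0 := onemX_neq0 n (lt_trans wr r1); have q0 := onemX_neq0 n q1.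
    rewrite /psi [(w - q) * _]mulrCA -mulrDr; congr (_ * _); rewrite mulrA -subrXX /geo.
    by field; rewrite w0 q0.
  - move=> n; apply: contM; first exact: cont_cst.
    case: n => [|n].
      have -> : (fun w : C => (\sum_(i < 0) w ^+ (0.-1 - i) * q ^+ i) /
         ((1 - w ^+ 0) * (1 - q ^+ 0))) = (fun=> 0).
        by apply/funext => w; rewrite big_ord0 mul0r.
      exact: cont_cst.
    apply: contM.
      apply: cont_sum => i; apply: contM (cont_cst _ _).
      exact: contX (cont_id _).
    apply: contV; last by rewrite mulf_neq0 // onemX_neq0.
    apply: contM (cont_cst _ _); apply: contB; first exact: cont_cst.
    exact: contX (cont_id _).
  - by apply: nearS nq => w wr n; exact: psi_le.
  - by apply: is_cvg_seriesZ; exact: is_cvg_pow_geo.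
  - by move=> n; exact: cnorm_lam_term.
  - by apply: is_cvg_seriesZ; exact: is_cvg_pow_geo.
rewrite /dlam -(@csumZ _ _ M).
- congr csum; apply/funext => -[|n].
    by rewrite /psi big_ord0 mul0r !mulr0 exprS mulr0n !mul0r.
  rewrite /psi /geo.
  rewrite sum_XX_diag.
  by rewrite !exprS; field; rewrite -exprS onemX_neq0.
- by move=> n; exact: psi_le.
- by apply: is_cvg_seriesZ; exact: is_cvg_pow_geo.
Qed.

End Lambert.

(** * Weighted products of Lambert series *)

Section LambertProducts.
Variable R : realType.
Local Notation C := R[i].
(* By [geoM] the terms p(i, m - i) u_i u_(m-i) become multiples of u_m and of the
   u_m u_i; subtracting them from the full double sum of p leaves the kernel h. *)
Variables (p h : C -> C -> C) (d : nat) (A B D : C) (q : C).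
Hypothesis q1 : cnorm q < 1.
Hypothesis p_sym : forall x y, p x y = p y x.
Hypothesis h_sym : forall x y, h x y = h y x.
Hypothesis hE : forall x y, h x y = p x y - p y (x - y).
Hypothesis h_diag : forall x, h x x = p x x - x ^+ d.
Hypothesis p0 : forall x, p 0 x = x ^+ d.
Hypothesis p_sum : forall m, \sum_(i < m) p i%:R (m%:R - i%:R) =
  A * m%:R ^+ 5 + B * m%:R ^+ 3 + D * m%:R.

Let u := geo q.
Let f (i j : nat) := h i%:R j%:R * (u i * u j).
Let g (i j : nat) := p i%:R j%:R * (u i * u j).
Let t (m : nat) := A * (m%:R ^+ 5 * u m) + B * (m%:R ^+ 3 * u m)
  + D * (m%:R ^+ 1 * u m) - m%:R ^+ d * (u m ^+ 2 + u m).

Let u0 : u 0 = 0. Proof. exact: geo0n. Qed.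

Let g0l j : g 0 j = 0. Proof. by rewrite /g u0 mul0r mulr0. Qed.

Let g0r i : g i 0 = 0. Proof. by rewrite /g u0 !mulr0. Qed.

Let f0l j : f 0 j = 0. Proof. by rewrite /f u0 mul0r mulr0. Qed.

Let f0r i : f i 0 = 0. Proof. by rewrite /f u0 !mulr0. Qed.

(** On the antidiagonal of m, [geoM] yields u_m (S + 2 T). T carries exactly the weights by which h
    differs from p in [hE], and S is evaluated by [p_sum]. The term i = 0 of [p_sum] and the defect
    in [h_diag] supply m^d (u_m + u_m^2), the derivative term. *)
Let level_identity m :
  \sum_(i < m) (f m i + f i m) + f m m =
  (\sum_(i < m) (g m i + g i m) + g m m) - \sum_(i < m.+1) g i (m - i)%N + t m.
Proof.
case: m => [|n].
  by rewrite !big_ord0 big_ord1 /f /g /t subn0 u0; ring.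
pose m : C := n.+1%:R.
pose S := \sum_(i < n) p i.+1%:R (m - i.+1%:R).
pose T := \sum_(i < n) p i.+1%:R (m - i.+1%:R) * u i.+1.
pose X := \sum_(i < n) p m i.+1%:R * u i.+1.
have fsum : \sum_(i < n.+1) (f n.+1 i + f i n.+1) = 2 * u n.+1 * (X - T).
  rewrite big_ord_recl f0l f0r !add0r.
  rewrite /X /T -sumrB mulr_sumr; apply: eq_bigr => i _.
  by rewrite /f lift0 (h_sym i.+1%:R) hE -/m; ring.
have gsum : \sum_(i < n.+1) (g n.+1 i + g i n.+1) = 2 * u n.+1 * X.
  rewrite big_ord_recl g0l g0r !add0r.
  rewrite /X mulr_sumr; apply: eq_bigr => i _.
  by rewrite /g lift0 (p_sym i.+1%:R) -/m; ring.
have tri : \sum_(i < n.+2) g i (n.+1 - i)%N = u n.+1 * (S + 2 * T).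
  rewrite big_ord_recl big_ord_recr /= !(g0l, g0r, lift0, subnn) addr0 add0r.
  have subm i : (i < n)%N -> (n - i)%:R = m - i.+1%:R.
    by move=> i_n; rewrite /m -natrB ?subSS // ltnS ltnW.
  (* Reflecting the antidiagonal exchanges the two arguments of p, which is symmetric. *)
  have rev : \sum_(i < n) p i.+1%:R (m - i.+1%:R) * u (n - i)%N = T.
    rewrite (reindex_inj rev_ord_inj) /=; apply: eq_bigr => i _.
    rewrite subKn // p_sym subnSK // subm //.
    by rewrite opprB addrC subrK.
  have -> : S + 2 * T = S + T + \sum_(i < n) p i.+1%:R (m - i.+1%:R) * u (n - i)%N.
    by rewrite rev; ring.
  rewrite /S /T -!big_split mulr_sumr /=; apply: eq_bigr => i _.
  rewrite /g subm //.
  have e : (n - i)%N = (n - i.+1).+1 by rewrite subnSK.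
  have -> : u i.+1 * u (n - i)%N = u n.+1 * (1 + u i.+1 + u (n - i)%N).
    by rewrite e /u geoM // addnS addSnnS -e addnC subnK // ltnW.
  by ring.
have pS : S = A * m ^+ 5 + B * m ^+ 3 + D * m - m ^+ d.
  have := p_sum n.+1; rewrite big_ord_recl /= subr0 p0 -/m => <-.
  by rewrite [RHS]addrC addKr.
rewrite fsum gsum tri pS /f /g /t h_diag -/m; ring.
Qed.

Lemma lambert_finite_identity N :
  \sum_(i < N) \sum_(j < N) f i j =
  \sum_(m < N) t m + \sum_(i < N) \sum_(j < N | (N <= i + j)%N) g i j.
Proof.
rewrite -sum_square_triangle !sum_square -sumrB -big_split.
by apply: eq_bigr => m _; rewrite level_identity addrC.
Qed.

End LambertProducts.

(** * Polynomial weights and passage to the limit *)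

Section PolynomialBound.
Variable R : realType.
Local Notation C := R[i].
Implicit Types (p : C -> C -> C) (q : C).

(** Polynomial growth in the side N of the square. This class is closed under the ring operations,
    so explicit kernels are certified by their syntax. *)
Definition polybd p := exists B : R, exists k, 0 <= B /\
  forall i j N, (i < N)%N -> (j < N)%N -> cnorm (p i%:R j%:R) <= B * N%:R ^+ k.

Lemma polybd_cst c : polybd (fun _ _ => c).
Proof.
exists (cnorm c), 0%N; split=> [|i j N _ _]; first exact: cnorm_ge0.
by rewrite expr0 mulr1.
Qed.

Lemma polybd_fst : polybd (fun x _ => x).
Proof.
by exists 1, 1%N; split=> // i j N iN _; rewrite cnorm_nat mul1r ler_nat ltnW.
Qed.

Lemma polybd_snd : polybd (fun _ y => y).
Proof.
by exists 1, 1%N; split=> // i j N _ jN; rewrite cnorm_nat mul1r ler_nat ltnW.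
Qed.

Lemma polybdD p p' : polybd p -> polybd p' -> polybd (fun x y => p x y + p' x y).
Proof.
move=> [B [k [B0 pB]]] [B' [k' [B'0 pB']]].
exists (B + B'), (k + k')%N; split=> [|i j N iN jN]; first exact: addr_ge0.
have N1 : 1 <= N%:R :> R by rewrite ler1n (leq_ltn_trans _ iN).
rewrite (le_trans (ler_cnormD _ _)) // mulrDl; apply: lerD.
  by rewrite (le_trans (pB _ _ _ iN jN)) // ler_wpM2l // ler_weXn2l // leq_addr.
by rewrite (le_trans (pB' _ _ _ iN jN)) // ler_wpM2l // ler_weXn2l // leq_addl.
Qed.

Lemma polybdN p : polybd p -> polybd (fun x y => - p x y).
Proof.
move=> [B [k [B0 pB]]]; exists B, k; split=> // i j N iN jN.
by rewrite cnormN pB.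
Qed.

Lemma polybdM p p' : polybd p -> polybd p' -> polybd (fun x y => p x y * p' x y).
Proof.
move=> [B [k [B0 pB]]] [B' [k' [B'0 pB']]].
exists (B * B'), (k + k')%N; split=> [|i j N iN jN]; first exact: mulr_ge0.
rewrite cnormM exprD mulrACA.
by apply: ler_pM; rewrite ?cnorm_ge0 ?pB ?pB'.
Qed.

Lemma polybdX p n : polybd p -> polybd (fun x y => p x y ^+ n).
Proof.
move=> hp; elim: n => [|n IH]; first exact: polybd_cst.
have := polybdM hp IH; congr polybd.
by apply/funext => x; apply/funext => y; rewrite exprS.
Qed.

(* Truncating a double series along squares or along triangles makes no difference
   in the limit. *)
Lemma cvg_corner p q : polybd p -> cnorm q < 1 ->
  (fun N => \sum_(i < N) \sum_(j < N | (N <= i + j)%N)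
     p i%:R j%:R * (geo q i * geo q j)) @ \oo --> (0 : C).
Proof.
move=> [B [k [B0 pB]]] /between_lt1 [r /ltW qr r01]; have /andP[r0 r1] := r01.
have r2 : 0 < 1 - r by rewrite subr_gt0.
have r0' := ltW r0; have r2' := ltW r2; have r1' := ltW r1.
pose K := B * (1 - r) ^- 2.
have K0 : 0 <= K by rewrite mulr_ge0 // invr_ge0 exprn_ge0 // ltW.
(* At most N^2 terms, each bounded by B N^k r^(i+j) / (1 - r)^2 with i + j >= N; hence the exponent
   k + 2. *)
apply: (@cvg_cnorm_le _ _ _ _ _ _ (fun N => K * (N.+1%:R ^+ k.+2 * r ^+ N))).
  apply: nearW => N; rewrite subr0 (le_trans (ler_cnorm_sum _ _ _)) //.
  apply: (@le_trans _ _ (\sum_(i < N) \sum_(j < N)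
      B * N%:R ^+ k * (r ^+ N * (1 - r) ^- 2))).
    apply: ler_sum => i _; rewrite (le_trans (ler_cnorm_sum _ _ _)) //.
    rewrite big_mkcond; apply: ler_sum => j _; case: ifP => [Nij|_].
      rewrite cnormM (cnormM (geo q i)).
      apply: ler_pM; rewrite ?mulr_ge0 ?cnorm_ge0 ?pB //.
      apply: (@le_trans _ _ (r ^+ (i + j) * (1 - r) ^- 2)).
        rewrite exprD -exprVn expr2 mulrACA.
        by apply: ler_pM; rewrite ?cnorm_ge0 ?cnorm_geo.
      rewrite ler_wpM2r ?invr_ge0 ?exprn_ge0 //.
      by rewrite ler_wiXn2l.
    by rewrite mulr_ge0 ?mulr_ge0 ?invr_ge0 ?exprn_ge0.
  rewrite !sumr_const !card_ord.
  rewrite (_ : _ *+ N *+ N = K * ((N%:R * N%:R * N%:R ^+ k) * r ^+ N)); last first.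
    by rewrite -mulrnA -[_ *+ (N * N)]mulr_natr natrM /K; ring.
  rewrite ler_wpM2l // ler_wpM2r ?exprn_ge0 //.
  rewrite -mulrA -!exprS; apply: lerXn2r; rewrite ?nnegrE // ler_nat //.
rewrite -(mulr0 K); apply: cvgM; first exact: cvg_cst.
exact: cvg_series_cvg_0 (is_cvg_pow_geo r01).
Qed.

Lemma dlam_cvg k q : cnorm q < 1 ->
  series (fun n => n%:R ^+ k.+1 * (geo q n ^+ 2 + geo q n)) @ \oo --> dlam k q.
Proof.
move=> /between_lt1 [r /ltW qr r01]; have /andP[r0 r1] := r01.
have r2 : 0 < 1 - r by rewrite subr_gt0.
apply: (@csum_cvg _ _ (fun n =>
    (1 + (1 - r)^-1) * ((1 - r)^-1 * (n.+1%:R ^+ k.+1 * r ^+ n)))).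
  move=> n; have -> : n%:R ^+ k.+1 * (geo q n ^+ 2 + geo q n) =
    (1 + geo q n) * (n%:R ^+ k.+1 * geo q n) by ring.
  rewrite cnormM; apply: ler_pM; rewrite ?cnorm_ge0 ?cnorm_lam_term //.
  rewrite (le_trans (ler_cnormD _ _)) // cnorm1 lerD2l.
  rewrite (le_trans (cnorm_geo _ qr r1)) // ler_piMl ?invr_ge0 ?exprn_ile1 // ltW //.
by do 2 apply: is_cvg_seriesZ; exact: is_cvg_pow_geo.
Qed.

Lemma cvg_series_ord (a : nat -> C) (l : C) : series a @ \oo --> l ->
  (fun N => \sum_(i < N) a i) @ \oo --> l.
Proof.
rewrite (_ : series a = (fun N => \sum_(i < N) a i)) //.
by apply/funext => n; rewrite /series /= big_mkord.
Qed.

(** The double sum of h is left unevaluated; for each kernel used below it is a combination of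
    products of two [lam]. *)
Lemma lambert_quadratic (p h : C -> C -> C) k (A B D : C) (q : C) :
  cnorm q < 1 -> polybd p ->
  (forall x y, p x y = p y x) -> (forall x y, h x y = h y x) ->
  (forall x y, h x y = p x y - p y (x - y)) ->
  (forall x, h x x = p x x - x ^+ k.+1) -> (forall x, p 0 x = x ^+ k.+1) ->
  (forall m, \sum_(i < m) p i%:R (m%:R - i%:R) =
     A * m%:R ^+ 5 + B * m%:R ^+ 3 + D * m%:R) ->
  (fun N => \sum_(i < N) \sum_(j < N) h i%:R j%:R * (geo q i * geo q j)) @ \oo -->
    A * lam 5 q + B * lam 3 q + D * lam 1 q - dlam k q.
Proof.
move=> q1 bp ps hs hE hd p0 pS.
have -> : (fun N => \sum_(i < N) \sum_(j < N) h i%:R j%:R * (geo q i * geo q j)) =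
  (fun N => (A * (\sum_(m < N) m%:R ^+ 5 * geo q m)
  + B * (\sum_(m < N) m%:R ^+ 3 * geo q m)
  + D * (\sum_(m < N) m%:R ^+ 1 * geo q m) -
  \sum_(m < N) m%:R ^+ k.+1 * (geo q m ^+ 2 + geo q m)) +
  \sum_(i < N) \sum_(j < N | (N <= i + j)%N) p i%:R j%:R * (geo q i * geo q j)).
  apply/funext => N; rewrite (lambert_finite_identity q1 ps hs hE hd p0 pS).
  by congr (_ + _); rewrite sumrB !big_split /= -!mulr_sumr.
rewrite -[X in _ --> X]addr0; apply: cvgD; last exact: cvg_corner.
have cZ c j : (fun N => c * (\sum_(m < N) m%:R ^+ j * geo q m)) @ \oo -->
    (c * lam j q : C).
  by apply: (@cvgM _ _ \oo); [exact: cvg_cst|exact: (cvg_series_ord (lam_cvg q1))].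
apply: cvgB; last exact: (cvg_series_ord (dlam_cvg q1)).
by apply: cvgD; [apply: cvgD|].
Qed.

Lemma cvg_lam_product a b q : cnorm q < 1 ->
  (fun N => \sum_(i < N) \sum_(j < N)
     i%:R ^+ a * j%:R ^+ b * (geo q i * geo q j)) @ \oo --> lam a q * lam b q.
Proof.
move=> q1.
have -> : (fun N => \sum_(i < N) \sum_(j < N)
     i%:R ^+ a * j%:R ^+ b * (geo q i * geo q j)) =
   (fun N => (\sum_(i < N) i%:R ^+ a * geo q i) * (\sum_(j < N) j%:R ^+ b * geo q j)).
  apply/funext => N; rewrite big_distrlr; apply: eq_bigr => i _.
  by apply: eq_bigr => j _; rewrite /=; ring.
apply: (@cvgM _ _ \oo); first exact: (cvg_series_ord (lam_cvg q1)).
exact: (cvg_series_ord (lam_cvg q1)).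
Qed.

End PolynomialBound.

Ltac prove_polybd := repeat match goal with
  | |- polybd (fun x y => @?f x y + @?g x y) => apply: (@polybdD _ f g)
  | |- polybd (fun x y => - @?f x y) => apply: (@polybdN _ f)
  | |- polybd (fun x y => @?f x y * @?g x y) => apply: (@polybdM _ f g)
  | |- polybd (fun x y => @?f x y ^+ ?n) => apply: (@polybdX _ f n)
  | |- polybd (fun x _ => x) => exact: polybd_fst
  | |- polybd (fun _ y => y) => exact: polybd_snd
  | |- polybd (fun _ _ => ?c) => exact: (@polybd_cst _ c)
  end.

(** * Ramanujan's differential equations *)

Section Ramanujan.
Variable R : realType.
Local Notation C := R[i].
Implicit Types (q : C).

Lemma cvg_sum2D (F G : nat -> nat -> C) (a b : C) :
  (fun N => \sum_(i < N) \sum_(j < N) F i j) @ \oo --> a ->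
  (fun N => \sum_(i < N) \sum_(j < N) G i j) @ \oo --> b ->
  (fun N => \sum_(i < N) \sum_(j < N) (F i j + G i j)) @ \oo --> (a + b).
Proof.
move=> cF cG.
rewrite (_ : (fun N => \sum_(i < N) \sum_(j < N) (F i j + G i j)) =
  (fun N => \sum_(i < N) \sum_(j < N) F i j + \sum_(i < N) \sum_(j < N) G i j)).
  exact: (@cvgD _ _ _ \oo _ _ _ _ _ cF cG).
apply/funext => N; rewrite -big_split; apply: eq_bigr => i _.
by rewrite -big_split.
Qed.

Lemma cvg_sum2Z (F : nat -> nat -> C) (a c : C) :
  (fun N => \sum_(i < N) \sum_(j < N) F i j) @ \oo --> a ->
  (fun N => \sum_(i < N) \sum_(j < N) (c * F i j)) @ \oo --> c * a.
Proof.
move=> cF.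
rewrite (_ : (fun N => \sum_(i < N) \sum_(j < N) (c * F i j)) =
  (fun N => c * \sum_(i < N) \sum_(j < N) F i j)).
  exact: (@cvgM _ _ \oo _ _ _ _ _ (@cvg_cst _ _ _ \oo _) cF).
apply/funext => N; rewrite mulr_sumr; apply: eq_bigr => i _.
by rewrite mulr_sumr.
Qed.

Lemma cvg_sum2_eq (F G : nat -> nat -> C) (a b : C) :
  (forall i j, F i j = G i j) ->
  (fun N => \sum_(i < N) \sum_(j < N) F i j) @ \oo --> a ->
  (fun N => \sum_(i < N) \sum_(j < N) G i j) @ \oo --> b -> a = b.
Proof.
move=> FG cF cG; rewrite -(cvg_lim _ cF) // -(cvg_lim _ cG) //.
congr (lim (_ @ \oo)); apply/funext => N.
by apply: eq_bigr => i _; apply: eq_bigr => j _.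
Qed.

Let mono q a b i j : C := i%:R ^+ a * j%:R ^+ b * (geo q i * geo q j).

Let smono q a b i j : C := mono q a b i j + mono q b a i j.

Let cvg_smono q a b : cnorm q < 1 ->
  (fun N => \sum_(i < N) \sum_(j < N) smono q a b i j) @ \oo -->
  lam a q * lam b q + lam b q * lam a q.
Proof. by move=> q1; apply: cvg_sum2D; exact: cvg_lam_product. Qed.

(** The form Q = x^2 + xy + y^2 satisfies Q(y, x - y) = Q(x, -y), so p = Q makes h twice the part of
    p odd in y, namely 2xy. *)
Lemma ramanujan2 q : cnorm q < 1 ->
  2 * (lam 1 q * lam 1 q) = (5 / 6) * lam 3 q + (1 / 6) * lam 1 q - dlam 1 q.
Proof.
move=> q1.
pose p (x y : C) : C := x ^+ 2 + x * y + y ^+ 2.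
pose h (x y : C) : C := 2 * x * y.
have := @lambert_quadratic R p h 1 0 (5 / 6) (1 / 6) q q1.
rewrite mul0r add0r => H.
have K : (fun N => \sum_(i < N) \sum_(j < N) 2 * mono q 1 1 i j) @ \oo -->
    (2 * (lam 1 q * lam 1 q) : C).
  by apply: cvg_sum2Z; exact: cvg_lam_product.
apply: (cvg_sum2_eq (F := fun i j => 2 * mono q 1 1 i j)
  (G := fun i j => h i%:R j%:R * (geo q i * geo q j)) _ K);
  last apply: H.
- move=> i j; rewrite ?/smono /mono /h.
  by move: (geo q i) (geo q j) (i%:R : C) (j%:R : C) => a b x y; ring.
- by rewrite /p; prove_polybd.
- by move=> x y; rewrite /p; ring.
- by move=> x y; rewrite /h; ring.
- by move=> x y; rewrite /h /p; ring.
- by move=> x; rewrite /h /p; ring.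
- by move=> x; rewrite /p; ring.
(* The bound n and the argument x are separated so that induction on n leaves the summand fixed. *)
suff E n (x : C) : \sum_(i < n) p i%:R (x - i%:R) =
    1 / 6 * n%:R + 1 / 2 * n%:R * x + n%:R * x ^+ 2 - 1 / 2 * n%:R ^+ 2
    - 1 / 2 * n%:R ^+ 2 * x + 1 / 3 * n%:R ^+ 3.
  by move=> m; rewrite E; field.
elim: n => [|n IH]; first by rewrite big_ord0; ring.
by rewrite big_ord_recr /= IH /p -natr1; field.
Qed.

(** The same kernel construction with p = Q^2, whose doubled odd part is 4 (x^3 y + x y^3). *)
Lemma ramanujan4 q : cnorm q < 1 ->
  8 * (lam 3 q * lam 1 q) =
  (7 / 10) * lam 5 q + (1 / 3) * lam 3 q + (- 1 / 30) * lam 1 q - dlam 3 q.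
Proof.
move=> q1.
pose p (x y : C) : C := (x ^+ 2 + x * y + y ^+ 2) ^+ 2.
pose h (x y : C) : C := 4 * (x ^+ 3 * y + x * y ^+ 3).
have := @lambert_quadratic R p h 3 (7 / 10) (1 / 3) (- 1 / 30) q q1 => H.
have -> : 8 * (lam 3 q * lam 1 q) =
  4 * (lam 3 q * lam 1 q + lam 1 q * lam 3 q) by ring.
have K : (fun N => \sum_(i < N) \sum_(j < N) 4 * smono q 3 1 i j) @ \oo -->
    (4 * (lam 3 q * lam 1 q + lam 1 q * lam 3 q) : C).
  by apply: cvg_sum2Z; exact: cvg_smono.
apply: (cvg_sum2_eq (F := fun i j => 4 * smono q 3 1 i j)
  (G := fun i j => h i%:R j%:R * (geo q i * geo q j)) _ K);
  last apply: H.
- move=> i j; rewrite ?/smono /mono /h.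
  by move: (geo q i) (geo q j) (i%:R : C) (j%:R : C) => a b x y; ring.
- by rewrite /p; prove_polybd.
- by move=> x y; rewrite /p; ring.
- by move=> x y; rewrite /h; ring.
- by move=> x y; rewrite /h /p; ring.
- by move=> x; rewrite /h /p; ring.
- by move=> x; rewrite /p; ring.
suff E n (x : C) : \sum_(i < n) p i%:R (x - i%:R) =
    - 1 / 30 * n%:R + 1 / 2 * n%:R * x ^+ 2 + n%:R * x ^+ 3 + n%:R * x ^+ 4
    - 1 / 2 * n%:R ^+ 2 * x - 3 / 2 * n%:R ^+ 2 * x ^+ 2 - n%:R ^+ 2 * x ^+ 3
    + 1 / 3 * n%:R ^+ 3 + n%:R ^+ 3 * x + n%:R ^+ 3 * x ^+ 2
    - 1 / 2 * n%:R ^+ 4 - 1 / 2 * n%:R ^+ 4 * x + 1 / 5 * n%:R ^+ 5.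
  by move=> m; rewrite E; field.
elim: n => [|n IH]; first by rewrite big_ord0; ring.
by rewrite big_ord_recr /= IH /p -natr1; field.
Qed.

(* The coefficient 165 / 14 makes the seventh powers cancel in the inner sum, so
   that no Eisenstein series of weight 8 appears. *)
Lemma ramanujan6 q : cnorm q < 1 ->
  12 * (lam 5 q * lam 1 q) - (400 / 7) * (lam 3 q * lam 3 q) =
  (1 / 2) * lam 5 q + (10 / 21) * lam 3 q + (1 / 42) * lam 1 q - dlam 5 q.
Proof.
move=> q1.
(* Here p = Q^3 - (249/14) (xy(x + y))^2. Both summands are invariant under (x, y) -> (-y, x + y),
   so that again p(y, x - y) = p(x, -y) and h is twice the odd part; this ties 200/7 to 165/14. *)
pose p (x y : C) : C := x ^+ 6 + y ^+ 6 + 3 * (x ^+ 5 * y + x * y ^+ 5)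
  - (165 / 14) * (x ^+ 4 * y ^+ 2 + x ^+ 2 * y ^+ 4)
  - (200 / 7) * (x ^+ 3 * y ^+ 3).
pose h (x y : C) : C := 6 * (x ^+ 5 * y + x * y ^+ 5)
   + (- (400 / 7)) * (x ^+ 3 * y ^+ 3).
have := @lambert_quadratic R p h 5 (1 / 2) (10 / 21) (1 / 42) q q1 => H.
have -> : 12 * (lam 5 q * lam 1 q) - (400 / 7) * (lam 3 q * lam 3 q) =
  6 * (lam 5 q * lam 1 q + lam 1 q * lam 5 q)
  + (- (400 / 7)) * (lam 3 q * lam 3 q) by ring.
have K : (fun N => \sum_(i < N) \sum_(j < N) (6 * smono q 5 1 i j
    + (- (400 / 7)) * mono q 3 3 i j)) @ \oo -->
    (6 * (lam 5 q * lam 1 q + lam 1 q * lam 5 q)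
    + (- (400 / 7)) * (lam 3 q * lam 3 q) : C).
  apply: (cvg_sum2D (F := fun i j => 6 * smono q 5 1 i j)
    (G := fun i j => (- (400 / 7)) * mono q 3 3 i j)); apply: cvg_sum2Z.
    exact: cvg_smono.
  exact: cvg_lam_product.
apply: (cvg_sum2_eq (F := fun i j =>
    6 * smono q 5 1 i j + (- (400 / 7)) * mono q 3 3 i j)
  (G := fun i j => h i%:R j%:R * (geo q i * geo q j)) _ K);
  last apply: H.
- move=> i j; rewrite ?/smono /mono /h.
  by move: (geo q i) (geo q j) (i%:R : C) (j%:R : C) => a b x y; ring.
- by rewrite /p; prove_polybd.
- by move=> x y; rewrite /p; ring.
- by move=> x y; rewrite /h; ring.
- by move=> x y; rewrite /h /p; field.
- by move=> x; rewrite /h /p; field.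
- by move=> x; rewrite /p; ring.
suff E n (x : C) : \sum_(i < n) p i%:R (x - i%:R) =
    1 / 42 * n%:R + 11 / 28 * n%:R * x ^+ 2 - 55 / 28 * n%:R * x ^+ 4
    + 3 / 2 * n%:R * x ^+ 5 + n%:R * x ^+ 6 + 1 / 4 * n%:R ^+ 2 * x
    + 50 / 7 * n%:R ^+ 2 * x ^+ 3 + 165 / 28 * n%:R ^+ 2 * x ^+ 4
    - 3 / 2 * n%:R ^+ 2 * x ^+ 5 - 1 / 6 * n%:R ^+ 3
    - 55 / 14 * n%:R ^+ 3 * x ^+ 2 - 100 / 7 * n%:R ^+ 3 * x ^+ 3
    - 55 / 14 * n%:R ^+ 3 * x ^+ 4 - 5 / 4 * n%:R ^+ 4 * x
    + 165 / 28 * n%:R ^+ 4 * x ^+ 2 + 50 / 7 * n%:R ^+ 4 * x ^+ 3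
    + 1 / 2 * n%:R ^+ 5 + 3 / 2 * n%:R ^+ 5 * x - 33 / 14 * n%:R ^+ 5 * x ^+ 2
    - 1 / 2 * n%:R ^+ 6 - 1 / 2 * n%:R ^+ 6 * x + 1 / 7 * n%:R ^+ 7.
  by move=> m; rewrite E; field.
elim: n => [|n IH]; first by rewrite big_ord0; ring.
by rewrite big_ord_recr /= IH /p -natr1; field.
Qed.

End Ramanujan.

(** * The hypergeometric equation *)

Section PowerSeries.
Variable R : realType.
Local Notation C := R[i].
Variable c : nat -> C.
Hypothesis c_le1 : forall n, cnorm (c n) <= 1.
Implicit Types (t w : C).

(* The operator (t d/dt)^k applied to the power series with coefficients c. *)
Definition thps k t : C := csum (fun n => n%:R ^+ k * (c n * t ^+ n)).

Lemma cnorm_thps_term k t r n : cnorm t <= r ->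
  cnorm (n%:R ^+ k * (c n * t ^+ n)) <= n.+1%:R ^+ k * r ^+ n.
Proof.
move=> tr; rewrite 2!cnormM !cnormX cnorm_nat.
apply: ler_pM; rewrite ?mulr_ge0 ?exprn_ge0 ?cnorm_ge0 //.
  by apply: lerXn2r; rewrite ?nnegrE // ler_nat.
rewrite -[leRHS]mul1r; apply: ler_pM; rewrite ?exprn_ge0 ?cnorm_ge0 //.
by apply: lerXn2r; rewrite ?nnegrE ?cnorm_ge0 // (le_trans (cnorm_ge0 t)).
Qed.

Lemma thps0 k : thps k 0 = 0 ^+ k * c 0%N.
Proof.
have r01 : (0 < 2^-1 :> R) && (2^-1 < 1 :> R) by rewrite invr_gt0 invf_lt1 ltr0n ?ltr1n.
rewrite /thps (@csum_recl _ _ (fun n => n.+1%:R ^+ k * 2^-1 ^+ n)).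
- rewrite expr0 mulr1 (_ : csum _ = 0) ?addr0 //.
  apply: csum_unique; rewrite (_ : series _ = cst 0); first exact: cvg_cst.
  apply/funext => n; rewrite /series /= big1 // => i _.
  by rewrite exprS mul0r !mulr0.
- by move=> n; apply: cnorm_thps_term; rewrite cnorm0 invr_ge0.
exact: is_cvg_pow_geo.
Qed.

Lemma cder_thps k t : cnorm t < 1 ->
  exists2 l, cder (thps k) t l & t * l = thps k.+1 t.
Proof.
move=> t1; have [r tr r01] := between_lt1 t1; have /andP[r0 r1] := r01.
have r0' := ltW r0.
pose psi n w : C := n%:R ^+ k * (c n * \sum_(i < n) w ^+ (n.-1 - i) * t ^+ i).
pose M n := r^-1 * (n.+1%:R ^+ k.+1 * r ^+ n).
have nt : \forall w \near t, cnorm w < r.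
  have rt : 0 < r - cnorm t by rewrite subr_gt0.
  have := cont_near (cont_id t) rt; apply: nearS => w h.
  have := ler_sub_cnorm w t; lra.
have psi_le w n : cnorm w < r -> cnorm (psi n w) <= M n.
  rewrite /M => /ltW wr; case: n => [|n].
    by rewrite /psi big_ord0 !mulr0 cnorm0 mulr_ge0 ?invr_ge0 // mulr_ge0.
  rewrite /psi cnormM cnormX cnorm_nat.
  have -> : r^-1 * (n.+2%:R ^+ k.+1 * r ^+ n.+1) = n.+2%:R ^+ k * (n.+2%:R * r ^+ n).
    by rewrite !exprS; field; rewrite gt_eqF.
  apply: ler_pM; rewrite ?exprn_ge0 ?cnorm_ge0 //.
    by apply: lerXn2r; rewrite ?nnegrE // ler_nat.
  rewrite cnormM -[leRHS]mul1r; apply: ler_pM; rewrite ?cnorm_ge0 //.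
  apply: le_trans (cnorm_sum_XX n wr (ltW tr)) _.
  by rewrite ler_wpM2r ?exprn_ge0 // ler_nat.
have cM : cvgn (series M) by apply: is_cvg_seriesZ; exact: is_cvg_pow_geo.
exists (csum (psi^~ t)).
  apply: (@cder_csum _ (fun n w => n%:R ^+ k * (c n * w ^+ n)) psi M
     (fun n => n.+1%:R ^+ k * r ^+ n)) => //.
  - apply: (@near_all _ t) => w n; rewrite /psi !(mulrCA (w - t)) -subrXX; ring.
  - move=> n; apply: contM; first exact: cont_cst.
    apply: contM; first exact: cont_cst.
    apply: cont_sum => i; apply: contM (cont_cst _ _).
    exact: contX (cont_id _).
  - by apply: nearS nt => w wr n; exact: psi_le.
  - by move=> n; apply: cnorm_thps_term; exact: ltW.
  - exact: is_cvg_pow_geo.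
rewrite /thps -(@csumZ _ _ M) //; last by move=> n; exact: psi_le.
congr csum; apply/funext => -[|n].
  by rewrite /psi big_ord0 !mulr0 exprS mulr0n !mul0r.
rewrite /psi.
rewrite sum_XX_diag.
by rewrite !exprS; ring.
Qed.

End PowerSeries.

Section Hypergeometric.
Variable R : realType.
Local Notation C := R[i].
Implicit Types (t : C) (n : nat).

Definition hyc n : C :=
  pochhammer (1 / 12) n * pochhammer (5 / 12) n / pochhammer 1 n / n`!%:R.

Lemma pochhammer1 n : pochhammer (1 : C) n = n`!%:R.
Proof.
rewrite /pochhammer; elim: n => [|n IH]; first by rewrite big_ord0.
by rewrite big_ord_recr /= IH nat1r factS mulnC natrM.
Qed.

Lemma hyc0 : hyc 0 = 1.
Proof. by rewrite /hyc /pochhammer !big_ord0 fact0 !divr1 mulr1. Qed.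

Lemma hycS n : n.+1%:R ^+ 2 * hyc n.+1 =
  (n%:R ^+ 2 + 1 / 2 * n%:R + 5 / 144) * hyc n.
Proof.
rewrite /hyc !pochhammer1 /pochhammer !big_ord_recr /= factS natrM.
have f0 : n`!%:R != 0 :> C by rewrite pnatr_eq0 -lt0n fact_gt0.
have n0 : n.+1%:R != 0 :> C by rewrite pnatr_eq0.
rewrite -natr1 in n0 *; field; exact/andP.
Qed.

(** Consecutive coefficients have ratio (n + 1/12)(n + 5/12) / (n + 1)^2, which is at most 1;
    bounded coefficients are enough inside the unit disc. *)
Lemma hyc_le1 n : cnorm (hyc n) <= 1.
Proof.
elim: n => [|n IH]; first by rewrite hyc0 cnorm1.
have n0 : n.+1%:R != 0 :> C by rewrite pnatr_eq0.
have -> : hyc n.+1 = (n%:R ^+ 2 + 1 / 2 * n%:R + 5 / 144) * hyc n / n.+1%:R ^+ 2.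
  by rewrite -hycS; field.
have n1 : 0 < n.+1%:R ^+ 2 :> R by rewrite exprn_gt0.
rewrite 2!cnormM cnormV cnormX cnorm_nat ler_pdivrMr // [leRHS]mulrC.
apply: ler_pM; rewrite ?cnorm_ge0 //.
apply: le_trans (ler_cnormD _ _) _.
apply: le_trans (lerD (ler_cnormD _ _) (lexx _)) _.
rewrite cnormX !cnormM !cnormV !cnorm_nat cnorm1 -(natr1 n) sqrrD1.
have : 0 <= n%:R :> R by [].
move: (n%:R : R) (n%:R ^+ 2) => x y; lra.
Qed.

Definition hyp k t : C := thps hyc k t.

(** With theta = t d/dt this reads theta^2 F = t (theta + 1/12)(theta + 5/12) F. It is the recursion
    [hycS] after an index shift, the constant term of theta^2 F being 0. *)
Lemma hyp_ode t : cnorm t < 1 ->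
  hyp 2 t = t * (hyp 2 t + 1 / 2 * hyp 1 t + 5 / 144 * hyp 0 t).
Proof.
move=> t1; have [r /ltW tr r01] := between_lt1 t1.
have le k n : cnorm (n%:R ^+ k * (hyc n * t ^+ n)) <= n.+1%:R ^+ k * r ^+ n.
  by apply: cnorm_thps_term => //; exact: hyc_le1.
have cv k : cvgn (series (fun n => n.+1%:R ^+ k * r ^+ n)) by exact: is_cvg_pow_geo.
have cvh k : series (fun n => n%:R ^+ k * (hyc n * t ^+ n)) @ \oo --> hyp k t.
  exact: csum_cvg (le k) (cv k).
rewrite {1}/hyp /thps (csum_recl (le 2%N) (cv 2%N)) expr0n mul0r add0r.
apply: csum_unique.
have -> : series (fun n => n.+1%:R ^+ 2 * (hyc n.+1 * t ^+ n.+1)) =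
  (fun N => t * (series (fun n => n%:R ^+ 2 * (hyc n * t ^+ n)) N
    + 1 / 2 * series (fun n => n%:R ^+ 1 * (hyc n * t ^+ n)) N
    + 5 / 144 * series (fun n => n%:R ^+ 0 * (hyc n * t ^+ n)) N)).
  apply/funext => N; rewrite /series /= !mulr_sumr -!big_split /= mulr_sumr.
  apply: eq_bigr => n _; rewrite mulrA hycS [t ^+ n.+1]exprS; ring.
have cZ (a : C) k :
    (fun N => a * series (fun n => n%:R ^+ k * (hyc n * t ^+ n)) N) @ \oo -->
    a * hyp k t.
  exact: (@cvgM _ _ \oo _ _ _ _ _ (@cvg_cst _ _ _ \oo _) (cvh k)).
apply: (@cvgM _ _ \oo); first exact: cvg_cst.
apply: (@cvgD _ _ _ \oo); last exact: cZ.
by apply: (@cvgD _ _ _ \oo).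
Qed.

Lemma hyp2F1_hyp t : hyp2F1 (1 / 12) (5 / 12) 1 t = hyp 0 t.
Proof.
rewrite /hyp2F1 /hyp /thps /csum; congr (lim (_ @ \oo)); apply/funext => N.
by apply: eq_bigr => n _; rewrite /hyc expr0 [RHS]mul1r [LHS]mulrA [LHS]mulrAC.
Qed.

End Hypergeometric.

(** * Eisenstein series and the Wronskian *)

Section EulerOperator.
Variable R : realType.
Local Notation C := R[i].
Implicit Types (q z m : C) (f g : C -> C).

Definition qder f q m := exists2 l, cder f q l & q * l = m.

Lemma qder_cont f q m : qder f q m -> cont f q.
Proof. by case=> l /cder_continuous. Qed.

Lemma qder_cst k q : qder (fun=> k) q 0.
Proof. by exists 0; [exact: cder_cst|rewrite mulr0]. Qed.

Lemma qderD f g q m n : qder f q m -> qder g q n ->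
  qder (fun w => f w + g w) q (m + n).
Proof.
move=> [l fl <-] [k gk <-]; exists (l + k); first exact: cderD.
by rewrite mulrDr.
Qed.

Lemma qderB f g q m n : qder f q m -> qder g q n ->
  qder (fun w => f w - g w) q (m - n).
Proof.
move=> [l fl <-] [k gk <-]; exists (l - k); first exact: cderB.
by rewrite mulrBr.
Qed.

Lemma qderM f g q m n : qder f q m -> qder g q n ->
  qder (fun w => f w * g w) q (m * g q + f q * n).
Proof.
move=> [l fl <-] [k gk <-]; exists (l * g q + f q * k); first exact: cderM.
by ring.
Qed.

Lemma qderZ f q m k : qder f q m -> qder (fun w => k * f w) q (k * m).
Proof. by move=> [l fl <-]; exists (k * l); [exact: cderZ|ring]. Qed.

Lemma qderX f q m n : qder f q m ->
  qder (fun w => f w ^+ n) q (n%:R * f q ^+ n.-1 * m).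
Proof.
by move=> [l fl <-]; exists (n%:R * f q ^+ n.-1 * l); [exact: cderX|ring].
Qed.

Lemma qderV f q m : qder f q m -> f q != 0 ->
  qder (fun w => (f w)^-1) q (- m / f q ^+ 2).
Proof.
move=> [l fl <-] f0; exists (- l / f q ^+ 2); first exact: cderV.
by rewrite mulrA mulrN.
Qed.

(** Here m is the logarithmic derivative D f / f and n is the value of t dg/dt at t = f q. *)
Lemma qder_comp f g q m n : qder f q (f q * m) -> qder g (f q) n ->
  qder (fun w => g (f w)) q (n * m).
Proof.
move=> [l fl e] [k gk <-]; exists (k * l); first exact: cder_comp fl gk.
by rewrite mulrCA e; ring.
Qed.

Lemma qder0_cder0 f q : q != 0 -> qder f q 0 -> cder f q 0.
Proof. by move=> q0 [l fl /eqP]; rewrite mulf_eq0 (negPf q0) => /eqP <-. Qed.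

Lemma near_cnorm_lt f z (r : R) : cont f z -> cnorm (f z) < r ->
  \forall w \near z, cnorm (f w) < r.
Proof.
move=> fc fz; have h : 0 < r - cnorm (f z) by rewrite subr_gt0.
apply: nearS (cont_near fc h) => w; have := ler_sub_cnorm (f w) (f z); lra.
Qed.

Lemma cst_eq_limit f (K : set C) z0 :
  cont f z0 -> (forall e : R, 0 < e -> exists2 z, K z & cnorm (z - z0) < e) ->
  (forall x y, K x -> K y -> f x = f y) -> forall z, K z -> f z = f z0.
Proof.
move=> fc acc cK z Kz; apply/eqP; rewrite -subr_eq0; apply/negP => /negP.
rewrite -cnorm_gt0 => h.
have /near_cnormP [e e0 he] := cont_near fc h.
have [w Kw wz] := acc _ e0; have := he w wz.
by rewrite (cK w z) // ltxx.
Qed.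

End EulerOperator.

Section Eisenstein.
Variable R : realType.
Local Notation C := R[i].
Implicit Types (q : C).

Definition eis2 q : C := 1 - 24 * lam 1 q.
Definition eis4 q : C := 1 + 240 * lam 3 q.
Definition eis6 q : C := 1 - 504 * lam 5 q.
Definition invJ q : C := (eis4 q ^+ 3 - eis6 q ^+ 2) / eis4 q ^+ 3.

Lemma qder_lam k q : cnorm q < 1 -> qder (lam k) q (dlam k q).
Proof. exact: cder_lam. Qed.

Lemma qder_eis2 q : cnorm q < 1 -> qder eis2 q ((eis2 q ^+ 2 - eis4 q) / 12).
Proof.
move=> q1; have h := qderB (qder_cst 1 q) (qderZ 24 (qder_lam 1 q1)).
have := h; congr qder; have := ramanujan2 q1; rewrite /eis2 /eis4 => e.
have -> : dlam 1 q = 5 / 6 * lam 3 q + 1 / 6 * lam 1 q - 2 * (lam 1 q * lam 1 q).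
  by rewrite e; ring.
by field.
Qed.

Lemma qder_eis4 q : cnorm q < 1 ->
  qder eis4 q ((eis2 q * eis4 q - eis6 q) / 3).
Proof.
move=> q1; have h := qderD (qder_cst 1 q) (qderZ 240 (qder_lam 3 q1)).
have := h; congr qder; have := ramanujan4 q1; rewrite /eis2 /eis4 /eis6 => e.
have -> : dlam 3 q = 7 / 10 * lam 5 q + 1 / 3 * lam 3 q + - 1 / 30 * lam 1 q
    - 8 * (lam 3 q * lam 1 q).
  by rewrite e; ring.
by field.
Qed.

Lemma qder_eis6 q : cnorm q < 1 ->
  qder eis6 q ((eis2 q * eis6 q - eis4 q ^+ 2) / 2).
Proof.
move=> q1; have h := qderB (qder_cst 1 q) (qderZ 504 (qder_lam 5 q1)).
have := h; congr qder; have := ramanujan6 q1; rewrite /eis2 /eis4 /eis6 => e.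
have -> : dlam 5 q = 1 / 2 * lam 5 q + 10 / 21 * lam 3 q + 1 / 42 * lam 1 q
    - (12 * (lam 5 q * lam 1 q) - 400 / 7 * (lam 3 q * lam 3 q)).
  by rewrite e; ring.
by field.
Qed.

Lemma cont_eis2 q : cnorm q < 1 -> cont eis2 q.
Proof. by move=> /qder_eis2/qder_cont. Qed.

Lemma cont_eis4 q : cnorm q < 1 -> cont eis4 q.
Proof. by move=> /qder_eis4/qder_cont. Qed.

Lemma cont_eis6 q : cnorm q < 1 -> cont eis6 q.
Proof. by move=> /qder_eis6/qder_cont. Qed.

Lemma eis_q0 : [/\ eis2 0 = 1, eis4 0 = 1 & eis6 0 = 1].
Proof. by rewrite /eis2 /eis4 /eis6 !lam_q0 !mulr0 !subr0 addr0. Qed.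

Lemma invJ_q0 : invJ 0 = 0.
Proof. by have [_ e4 e6] := eis_q0; rewrite /invJ e4 e6 !expr1n subrr mul0r. Qed.

Lemma qder_invJ q : cnorm q < 1 -> eis4 q != 0 ->
  qder invJ q (invJ q * (eis6 q / eis4 q)).
Proof.
move=> q1 e40.
have d4 := qder_eis4 q1; have d6 := qder_eis6 q1.
have d43 := qderX 3 d4.
have := qderM (qderB d43 (qderX 2 d6)) (qderV d43 (expf_neq0 3 e40)).
congr qder; rewrite /invJ /=.
by move: (eis2 q) (eis4 q) (eis6 q) e40 => x y z y0; field.
Qed.

Lemma cont_invJ q : cnorm q < 1 -> eis4 q != 0 -> cont invJ q.
Proof. by move=> q1 e40; apply: qder_cont (qder_invJ q1 e40). Qed.

(** Removing q = 0 lets D g = 0 imply g' = 0. Where E4 vanishes, [invJ] has the default value 0, so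
    the condition on [eis4] does not follow from the last one. *)
Definition cusp_region : set C :=
  [set q | [/\ cnorm q < 1, q != 0, eis4 q != 0 & cnorm (invJ q) < 1]].

Lemma open_cusp_region : open cusp_region.
Proof.
rewrite openE => q [q1 q0 e40 t1].
have n1 := near_cnorm_lt (cont_id q) q1.
have n2 := cont_neq0 (cont_id q) q0.
have n3 := cont_neq0 (cont_eis4 q1) e40.
have n4 := near_cnorm_lt (cont_invJ q1 e40) t1.
have n12 : \forall w \near q, cnorm w < 1 /\ w != 0 by apply: nearS2 n1 n2.
have n34 : \forall w \near q, eis4 w != 0 /\ cnorm (invJ w) < 1.
  by apply: nearS2 n3 n4.
by apply: nearS2 n12 n34 => w [h1 h2] [h3 h4].
Qed.

Lemma one_sub_invJ q : eis4 q != 0 -> 1 - invJ q = eis6 q ^+ 2 / eis4 q ^+ 3.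
Proof. by rewrite /invJ; move: (eis4 q) (eis6 q) => x y x0; field. Qed.

(** A zero of E6 would give 1/J = 1, on the boundary of the disc. *)
Lemma cusp_region_eis6 q : cusp_region q -> eis6 q != 0.
Proof.
move=> [_ _ e40 t1]; apply: contraTneq t1 => e60.
have /eqP := one_sub_invJ e40; rewrite e60 expr0n mul0r subr_eq0 => /eqP <-.
by rewrite cnorm1 ltxx.
Qed.

Definition hypq k q : C := hyp k (invJ q).

Lemma qder_hypq k q : cusp_region q ->
  qder (hypq k) q (hypq k.+1 q * (eis6 q / eis4 q)).
Proof.
move=> [q1 _ e40 t1].
by apply: (qder_comp (qder_invJ q1 e40)); apply: cder_thps => //; exact: hyc_le1.
Qed.

Lemma hypq_q0 k : hypq k 0 = 0 ^+ k.
Proof. by rewrite /hypq invJ_q0 /hyp thps0 ?hyc0 ?mulr1 //; exact: hyc_le1. Qed.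

Lemma cont_hypq_q0 k : cont (hypq k) 0.
Proof.
have [_ e4 _] := eis_q0; have c1 : cnorm (0 : C) < 1 by rewrite cnorm0.
have e40 : eis4 (0 : C) != 0 by rewrite e4 oner_neq0.
apply: cont_comp (cont_invJ c1 e40) _; rewrite invJ_q0.
have [l /cder_continuous] := @cder_thps R (@hyc R) (@hyc_le1 R) k 0 c1.
by [].
Qed.

(* The Wronskian of [hypq 0] and of [E4^(1/4)], up to a factor. *)
Definition wronsk q : C :=
  12 * (eis6 q * hypq 1 q) - (eis2 q * eis4 q - eis6 q) * hypq 0 q.

Lemma hypq_ode q : cusp_region q -> hypq 2 q * eis6 q ^+ 2 =
  (eis4 q ^+ 3 - eis6 q ^+ 2) * (1 / 2 * hypq 1 q + 5 / 144 * hypq 0 q).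
Proof.
move=> [q1 _ e40 t1]; have := hyp_ode t1.
rewrite -/(hypq 2 q) -/(hypq 1 q) -/(hypq 0 q).
set X := 1 / 2 * hypq 1 q + 5 / 144 * hypq 0 q => e.
have e' : hypq 2 q * (1 - invJ q) = invJ q * X.
  move: e; rewrite /X.
  move: (hypq 2 q) (hypq 1 q) (hypq 0 q) (invJ q) => x y z t e.
  by rewrite mulrBr mulr1 {1}e; ring.
have -> : eis6 q ^+ 2 = (1 - invJ q) * eis4 q ^+ 3.
  by rewrite (one_sub_invJ e40) (divfK (expf_neq0 3 e40)).
rewrite mulrA {}e' /invJ.
by move: (eis4 q) (eis6 q) (X) e40 => x y z x0; field.
Qed.

(** Abel's identity: D W is a multiple of W because both functions solve the same second-order
    equation. The factor is 5/4 of D E4 / E4, which explains the ratio W^4 / E4^5. *)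
Lemma qder_wronsk q : cusp_region q ->
  qder wronsk q (5 / 12 * ((eis2 q * eis4 q - eis6 q) / eis4 q) * wronsk q).
Proof.
move=> Vq; have e60 := cusp_region_eis6 Vq; have ode := hypq_ode Vq.
have [q1 q0 e40 t1] := Vq.
have d2 := qder_eis2 q1; have d4 := qder_eis4 q1; have d6 := qder_eis6 q1.
have f0 := qder_hypq 0 Vq; have f1 := qder_hypq 1 Vq.
have := qderB (qderZ 12 (qderM d6 f1)) (qderM (qderB (qderM d2 d4) d6) f0).
congr qder.
have -> : hypq 2 q = (eis4 q ^+ 3 - eis6 q ^+ 2) *
    (1 / 2 * hypq 1 q + 5 / 144 * hypq 0 q) / eis6 q ^+ 2.
  by rewrite -ode (mulfK (expf_neq0 2 e60)).
rewrite /wronsk; move: (eis2 q) (eis4 q) (eis6 q) (hypq 1 q) (hypq 0 q) e40 e60.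
by move=> x y z t s y0 z0; field; rewrite y0 z0.
Qed.

Lemma cder_wronsk_ratio q : cusp_region q ->
  cder (fun w => wronsk w ^+ 4 / eis4 w ^+ 5) q 0.
Proof.
move=> Vq; have [q1 q0 e40 t1] := Vq; apply: qder0_cder0 => //.
have d4 := qder_eis4 q1; have dW := qder_wronsk Vq.
have := qderM (qderX 4 dW) (qderV (qderX 5 d4) (expf_neq0 5 e40)).
congr qder; move: (eis2 q) (eis4 q) (eis6 q) (wronsk q) e40 => x y z t y0.
by field.
Qed.

(** W = 0 says 4 E4 D f = f D E4 for f = [hypq 0], which is the vanishing of the logarithmic
    derivative of f^4 / E4 after clearing denominators. *)
Lemma cder_hypq_ratio q : cusp_region q -> wronsk q = 0 ->
  cder (fun w => hypq 0 w ^+ 4 / eis4 w) q 0.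
Proof.
move=> Vq W0; have [q1 q0 e40 t1] := Vq; apply: qder0_cder0 => //.
have e60 := cusp_region_eis6 Vq.
have d4 := qder_eis4 q1; have d0 := qder_hypq 0 Vq.
have := qderM (qderX 4 d0) (qderV d4 e40).
congr qder; have -> : hypq 1 q =
    (wronsk q + (eis2 q * eis4 q - eis6 q) * hypq 0 q) / (12 * eis6 q).
  rewrite /wronsk; move: (eis2 q * eis4 q) (eis6 q) (hypq 1 q) (hypq 0 q) e60.
  by move=> x y z t y0; field.
rewrite W0; move: (eis2 q) (eis4 q) (eis6 q) (hypq 0 q) e40 e60.
by move=> x y z t y0 z0; field; rewrite y0 z0.
Qed.

End Eisenstein.

(** For z = iy the real part of z^2 (1 - t) is -y^2 (1 - Re t) <= 0, so the product cannot be 1. *)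
Lemma Re_neq0_of_sqr (R : realType) (z t : R[i]) :
  z ^+ 2 * (1 - t) = 1 -> cnorm t < 1 -> complex.Re z != 0.
Proof.
case: z t => x y [a b] /= e t1; apply: contra_eqN e => /eqP ->.
have a1 : `|a| < 1 by apply: le_lt_trans t1; exact: (normr_Re_le (a +i* b)).
rewrite eq_complex negb_and; apply/orP; left; rewrite expr2; simpc.
move: a1; rewrite ltr_norml => /andP[h1 h2].
rewrite /=; apply/eqP => e; have : 0 <= y * y * (1 - a) by nra.
by move: e; simpc => /=; nra.
Qed.

(** * Propagation from the cusp along a connected set *)

Section ConnectedToCusp.
Variable R : realType.
Local Notation C := R[i].
Variable K : set C.
Hypothesis K_connected : connected K.
Hypothesis K_region : K `<=` @cusp_region R.
Hypothesis K_cusp : forall e : R, 0 < e -> exists2 q, K q & cnorm q < e.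
Implicit Types (q : C).

Let K_cusp0 (e : R) : 0 < e -> exists2 q, K q & cnorm (q - 0) < e.
Proof. by move=> /K_cusp [q Kq qe]; exists q => //; rewrite subr0. Qed.

Let cnorm_0_lt1 : cnorm (0 : C) < 1. Proof. by rewrite cnorm0. Qed.

Let eis4_0_neq0 : eis4 (0 : C) != 0.
Proof. by have [_ -> _] := @eis_q0 R; exact: oner_neq0. Qed.

Lemma wronsk_eq0 q : K q -> wronsk q = 0.
Proof.
move=> Kq; have [_ _ e40 _] := K_region Kq.
have c0 : cont (fun w : C => wronsk w ^+ 4 / eis4 w ^+ 5) 0.
  have c2 := cont_eis2 cnorm_0_lt1; have c4 := cont_eis4 cnorm_0_lt1.
  have c6 := cont_eis6 cnorm_0_lt1.
  apply: contM.
    apply: contX; apply: contB; apply: contM; try exact: cont_cst.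
    - by apply: contM => //; exact: cont_hypq_q0.
    - by apply: contB => //; exact: contM.
    - exact: cont_hypq_q0.
  exact: (contV (contX 5 c4) (expf_neq0 5 eis4_0_neq0)).
have : wronsk q ^+ 4 / eis4 q ^+ 5 = wronsk 0 ^+ 4 / eis4 0 ^+ 5.
  apply: (cst_eq_limit c0 K_cusp0) Kq; apply: connected_locally_cst => // z Kz.
  apply: near_cst_of_cder0 (K_region Kz); first exact: open_cusp_region.
  exact: cder_wronsk_ratio.
have [e2 e4 e6] := @eis_q0 R.
have -> : wronsk (0 : C) = 0 by rewrite /wronsk e2 e4 e6 !hypq_q0; ring.
by rewrite expr0n mul0r => /(expf_div_eq0 e40).
Qed.

Lemma hypq_pow4 q : K q -> hypq 0 q ^+ 4 = eis4 q.
Proof.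
move=> Kq; have [_ _ e40 _] := K_region Kq.
have c0 : cont (fun w : C => hypq 0 w ^+ 4 / eis4 w) 0.
  apply: contM; first by apply: contX; exact: cont_hypq_q0.
  exact: (contV (cont_eis4 cnorm_0_lt1) eis4_0_neq0).
(* Local constancy of f^4 / E4 needs W = 0 on an open set around each point of K. V is open because
   W^4 / E4^5 is locally constant on the whole region. *)
pose V : set C := [set w | cusp_region w /\ wronsk w = 0].
have oV : open V.
  rewrite openE => z [Vz Wz].
  have n1 : \forall w \near z, cusp_region w.
    exact: open_nbhs_nbhs (conj (@open_cusp_region R) Vz).
  have n2 := near_cst_of_cder0 (@open_cusp_region R) (@cder_wronsk_ratio R) Vz.
  apply: nearS2 n1 n2 => w Vw; rewrite Wz expr0n mul0r.
  by have [_ _ w4 _] := Vw => /(expf_div_eq0 w4).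
have : hypq 0 q ^+ 4 / eis4 q = hypq 0 0 ^+ 4 / eis4 0.
  apply: (cst_eq_limit c0 K_cusp0) Kq; apply: connected_locally_cst => // z Kz.
  apply: (near_cst_of_cder0 oV) => [w [Vw Ww]|]; first exact: cder_hypq_ratio.
  by split; [exact: K_region|exact: wronsk_eq0].
have [_ -> _] := @eis_q0 R; rewrite hypq_q0 expr0 expr1n divr1 => h.
by rewrite -[LHS](divfK e40) h mul1r.
Qed.

Lemma theta_hypq q : K q ->
  12 * (eis6 q * hypq 1 q) = (eis2 q * eis4 q - eis6 q) * hypq 0 q.
Proof. by move=> /wronsk_eq0 /eqP; rewrite /wronsk subr_eq0 => /eqP. Qed.

(** By F^4 = E4 the square is E4^3 / E6^2, the inverse of 1 - 1/J. *)
Lemma hypq_quotient_sqr q : K q ->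
  (hypq 0 q ^+ 2 * eis4 q / eis6 q) ^+ 2 * (1 - invJ q) = 1.
Proof.
move=> Kq; have [q1 _ e40 t1] := K_region Kq.
have e60 := cusp_region_eis6 (K_region Kq); rewrite one_sub_invJ //.
have -> : (hypq 0 q ^+ 2 * eis4 q / eis6 q) ^+ 2 =
   hypq 0 q ^+ 4 * eis4 q ^+ 2 / eis6 q ^+ 2.
  by move: (hypq 0 q) (eis4 q) (eis6 q) e60 => x y z z0; field.
rewrite hypq_pow4 //; move: (eis4 q) (eis6 q) e40 e60 => x y x0 y0.
by field; rewrite x0 y0.
Qed.

Let rho q : C := hypq 0 q ^+ 2 * eis4 q / eis6 q.

Lemma hypq_quotient_Re_gt0 q : K q -> 0 < complex.Re (hypq 0 q ^+ 2 * eis4 q / eis6 q).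
Proof.
have rhoc q' : K q' -> cont rho q'.
  move=> Kq; have [q1 _ e40 t1] := K_region Kq.
  have e60 := cusp_region_eis6 (K_region Kq).
  apply: contM; first (apply: contM; last exact: cont_eis4).
    by apply: contX; apply: qder_cont (qder_hypq 0 (K_region Kq)).
  exact: (contV (cont_eis6 q1) e60).
have rho0 : cont rho 0.
  apply: contM; first (apply: contM; last exact: cont_eis4).
    by apply: contX; exact: cont_hypq_q0.
  apply: contV; first exact: cont_eis6.
  by have [_ _ ->] := @eis_q0 R; exact: oner_neq0.
(* A point nearer to z than the imaginary axis is lies on the same side of that axis. *)
have sgn (z w : C) : cnorm (w - z) < `|complex.Re z| ->
    (0 < complex.Re w) = (0 < complex.Re z).
  move=> h; have := le_lt_trans (normr_Re_le _) h; rewrite ReD ReN.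
  case: (ltrgt0P (complex.Re z)) => [z0|z0|->].
  - by rewrite ltr_norml => /andP[h1 h2]; apply/idP; lra.
  - by rewrite ltr_norml => /andP[h1 h2]; apply/negP/negP; rewrite -leNgt; lra.
  - by rewrite ltNge normr_ge0.
have rho00 : rho 0 = 1.
  have [_ e4 e6] := @eis_q0 R.
  by rewrite /rho e4 e6 hypq_q0 expr0 expr1n divr1 mulr1.
have [q0 Kq0 q0rho] : exists2 q0, K q0 & 0 < complex.Re (rho q0).
  have /near_cnormP [e e0 he] := cont_near rho0 ltr01.
  have [q0 Kq0 h0] := K_cusp0 e0; exists q0 => //.
  by rewrite (sgn (rho 0)) ?rho00 //= normr1 -?rho00 ?he.
move=> Kq; rewrite -/(rho q).
pose sg z := 0 < complex.Re (rho z).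
suff e : sg q = sg q0 by rewrite -/(sg q) e.
apply: (connected_locally_cst K_connected _ Kq Kq0) => z Kz.
have Rz : 0 < `|complex.Re (rho z)|.
  rewrite normr_gt0; apply: Re_neq0_of_sqr (hypq_quotient_sqr Kz) _.
  by have [] := K_region Kz.
by apply: nearS (cont_near (rhoc _ Kz) Rz) => w /sgn.
Qed.

End ConnectedToCusp.

(** * The nome and the principal square root *)

Section Nome.
Variable R : realType.
Local Notation C := R[i].
Implicit Types (z tau : C).

Lemma cnorm_cexp z : cnorm (cexp z) = expR (complex.Re z).
Proof.
rewrite /cexp cnormM cnormR ger0_norm ?expR_ge0 //.
by rewrite [X in _ * X]/cnorm /= cos2Dsin2 sqrtr1 mulr1.
Qed.

Lemma cont_cexp z : cont (@cexp R) z.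
Proof.
apply/contP.
have cr : (fun w : C => complex.Re w) @ z --> complex.Re z.
  by apply: (@cvg_Re _ _ (nbhs z)); exact: cvg_id.
have ci : (fun w : C => complex.Im w) @ z --> complex.Im z.
  by apply: (@cvg_Im _ _ (nbhs z)); exact: cvg_id.
have ce : (fun w : C => expR (complex.Re w)) @ z --> expR (complex.Re z).
  exact: (@continuous_cvg _ _ _ (nbhs z) _ _ _ _ (@continuous_expR R _) cr).
have cc : (fun w : C => cos (complex.Im w)) @ z --> cos (complex.Im z).
  exact: (@continuous_cvg _ _ _ (nbhs z) _ _ _ _ (@continuous_cos R _) ci).
have cs : (fun w : C => sin (complex.Im w)) @ z --> sin (complex.Im z).
  exact: (@continuous_cvg _ _ _ (nbhs z) _ _ _ _ (@continuous_sin R _) ci).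
have E : @cexp R = (fun w => (expR (complex.Re w) * cos (complex.Im w)) +i*
    (expR (complex.Re w) * sin (complex.Im w))).
  by apply/funext => w; rewrite /cexp; simpc.
rewrite E; apply: (@cvg_ReIm _ _ (nbhs z)) => /=.
  exact: (@cvgM _ _ (nbhs z) _ _ _ _ _ ce cc).
exact: (@cvgM _ _ (nbhs z) _ _ _ _ _ ce cs).
Qed.

Lemma cont_nome tau : cont (@nome R) tau.
Proof.
apply: cont_comp (cont_cexp _).
by apply: contM; [exact: cont_cst|exact: cont_id].
Qed.

Lemma cnorm_nome tau : cnorm (nome tau) = expR (- (2 * pi * complex.Im tau)).
Proof.
rewrite cnorm_cexp; congr expR; case: tau => x y.
have -> : 2 * pi%:C * 'i * (x +i* y) = (2 * pi)%:C * ('i * (x +i* y)) :> C.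
  by rewrite rmorphM /= rmorph_nat !mulrA.
by simpc.
Qed.

Lemma nome_neq0 tau : nome tau != 0.
Proof. by rewrite -cnorm_gt0 cnorm_nome expR_gt0. Qed.

Lemma nome_lt1 tau : 0 < complex.Im tau -> cnorm (nome tau) < 1.
Proof.
by move=> t0; rewrite cnorm_nome expR_lt1 oppr_lt0 !mulr_gt0 // pi_gt0.
Qed.

Lemma E2_eis2 tau : E2 tau = eis2 (nome tau).
Proof. by rewrite /E2 lambert_lam. Qed.

Lemma E4_eis4 tau : E4 tau = eis4 (nome tau).
Proof. by rewrite /E4 lambert_lam. Qed.

Lemma E6_eis6 tau : E6 tau = eis6 (nome tau).
Proof. by rewrite /E6 lambert_lam. Qed.

Lemma invJ_nome tau : 1 / kleinJ tau = invJ (nome tau).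
Proof. by rewrite div1r /kleinJ invf_div E4_eis4 E6_eis6. Qed.

Lemma invJ_lt1_cusp_region tau : invJ_lt1 tau -> cusp_region (nome tau).
Proof.
move=> [[t0 _ _] J0 J1]; split.
- exact: nome_lt1.
- exact: nome_neq0.
- apply: contraNneq J0 => e40.
  by rewrite /kleinJ E4_eis4 e40 expr0n mul0r.
- by rewrite -ltcR -cnormE -invJ_nome.
Qed.

Lemma nome_component_connected tau :
  connected (@nome R @` connected_component (@invJ_lt1 R) tau).
Proof.
apply: connected_continuous_connected; first exact: component_connected.
by apply: continuous_subspaceT => z; apply/contP; exact: cont_nome.
Qed.

Lemma nome_component_region tau :
  @nome R @` connected_component (@invJ_lt1 R) tau `<=` @cusp_region R.
Proof.
by move=> q [z /connected_component_sub zJ <-]; exact: invJ_lt1_cusp_region.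
Qed.

Lemma nome_component_cusp tau : C_invJ_oo tau -> forall e : R, 0 < e ->
  exists2 q, (@nome R @` connected_component (@invJ_lt1 R) tau) q & cnorm q < e.
Proof.
(* The nome sends the half-plane above this height into the disc of radius e. *)
move=> [_ H] e e0; have [z Cz Mz] := H (- ln e / (2 * pi)).
exists (nome z); first by exists z.
rewrite cnorm_nome -[ltRHS]lnK ?posrE // ltr_expR ltrNl.
by rewrite mulrC -ltr_pdivrMr // mulr_gt0 // pi_gt0.
Qed.

End Nome.

(** * Quotients of principal square roots *)

Section PrincipalRoot.
Variable R : realType.
Local Notation C := R[i].
Implicit Types (z w : C).

(** z and z - r have the same imaginary part, so their principal roots lie in one closed quadrant.
    In coordinates the common sign g of their imaginary parts enters only as g^2. *)
Lemma Re_sqrtc_div_ge0 z (r : R) :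
  0 <= complex.Re (sqrtc z / sqrtc (z - r%:C)).
Proof.
case: z => x y; rewrite -[_ - _]/((x - r) +i* (y - 0)) subr0 /sqrtc.
set p := Num.sqrt _; set s := Num.sqrt _; set p' := Num.sqrt _; set s' := Num.sqrt _.
set g := if _ then _ else _.
rewrite -[_ / _]/((p * (p' / (p' ^+ 2 + (g * s') ^+ 2)) -
   (g * s) * (- ((g * s') / (p' ^+ 2 + (g * s') ^+ 2)))) +i* _) /=.
set n := p' ^+ 2 + _.
have n0 : 0 <= n^-1 by rewrite invr_ge0 addr_ge0 ?sqr_ge0.
have -> : p * (p' / n) - g * s * - (g * s' / n) = (p * p' + g ^+ 2 * (s * s')) * n^-1.
  by ring.
have [p0 p0' s0 s0'] : [/\ 0 <= p, 0 <= p', 0 <= s & 0 <= s'].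
  by split; exact: sqrtr_ge0.
apply: mulr_ge0 => //; apply: addr_ge0; first exact: mulr_ge0.
by apply: mulr_ge0; [exact: sqr_ge0|exact: mulr_ge0].
Qed.

(** Both sides are square roots of 1 / (1 - 1/z) with positive real part, so they cannot be
    opposite. *)
Lemma sqrtc_ratio z w : z != 0 -> cnorm (1 / z) < 1 ->
  0 < complex.Re w -> w ^+ 2 * (1 - 1 / z) = 1 ->
  sqrtc z / sqrtc (z - 1) = w.
Proof.
move=> z0 z1 w0 wE.
have z10 : z - 1 != 0.
  rewrite subr_eq0; apply: contraTneq z1 => ->.
  by rewrite divr1 cnorm1 ltxx.
set v := sqrtc z / _.
have vE : v ^+ 2 * (1 - 1 / z) = 1.
  by rewrite expr_div_n !sqr_sqrtc; field; rewrite z0 z10.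
have v0 : 0 < complex.Re v.
  rewrite lt_neqAle eq_sym (Re_neq0_of_sqr vE z1) /=.
  exact: (Re_sqrtc_div_ge0 z 1).
have t0 : 1 - 1 / z != 0.
  by apply: contraPneq wE => ->; rewrite mulr0 => /esym/eqP; rewrite oner_eq0.
have /eqP := etrans vE (esym wE); rewrite (inj_eq (mulIf t0)) eqf_sqr.
case/orP => /eqP // e; move: v0; rewrite e ReN oppr_gt0 => v0.
by have := lt_trans v0 w0; rewrite ltxx.
Qed.

End PrincipalRoot.

Section HypergeometricDerivative.
Variable R : realType.
Local Notation C := R[i].
Implicit Types J : C.

Lemma hypF_hyp J : hypF J = hyp 0 (1 / J).
Proof. by rewrite /hypF hyp2F1_hyp. Qed.

(** In the variable t = 1/J the operator J d/dJ is -t d/dt. *)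
Lemma derive1_hypF_sqr J : J != 0 -> cnorm (1 / J) < 1 ->
  J * derive1 (fun w => hypF w ^+ 2) J = - 2 * (hyp 0 (1 / J) * hyp 1 (1 / J)).
Proof.
move=> J0 J1; have [l hl e] := @cder_thps R (@hyc R) (@hyc_le1 R) 0 _ J1.
rewrite -[hyp 1 _]/(thps (@hyc R) 1 (1 / J)) -e.
have dinv : cder (fun w : C => 1 / w) J (- 1 / J ^+ 2).
  by under eq_fun do rewrite div1r; exact: cderV (cder_id J) J0.
have d : cder (@hypF R) J (l * (- 1 / J ^+ 2)).
  rewrite (_ : @hypF R = fun w => hyp 0 (1 / w)); first exact: cder_comp dinv hl.
  by apply/funext => w; exact: hypF_hyp.
by rewrite (cder_derive1 (cderX 2 d)) hypF_hyp /=; field.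
Qed.

End HypergeometricDerivative.

Lemma Im_quadratic_root (R : realType) (a b d : int) : 0 < a ->
  let tau : R[i] := (- b%:~R + sqrtc (- d)%:~R) / (2 * a%:~R) in
  0 < complex.Im tau ->
  (0 : R) < d%:~R /\ complex.Im tau = Num.sqrt d%:~R / (2 * a%:~R).
Proof.
move=> a0 tau.
have a0' : (0 : R) < a%:~R by rewrite ltr0z.
have E : complex.Im tau = complex.Im (sqrtc ((- d)%:~R : R)%:C) / (2 * a%:~R).
  have H (u : R[i]) (k l : R) : complex.Im ((- l%:C + u) * k%:C) = complex.Im u * k.
    by case: u => x y; simpc.
  rewrite -(H _ _ b%:~R); congr complex.Im.
  by rewrite /tau fmorphV rmorphM rmorph_nat !rmorph_int.
(* For d <= 0 the root of -d is real, and Im(tau) would be 0. *)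
rewrite E; case: (lerP (d%:~R : R) 0) => d0.
  rewrite sqrtc_sqrtr; first by rewrite /= mul0r ltxx.
  by rewrite ler0c rmorphN /= oppr_ge0.
move=> _; split=> //; congr (_ / _).
have -> : ((- d)%:~R : R)%:C = (- d%:~R) +i* 0 :> R[i] by rewrite rmorphN.
rewrite /sqrtc eqxx mul1r expr0n addr0 sqrtr_sqr normrN ger0_norm ?ltW // opprK.
by congr Num.sqrt; field.
Qed.

(* sqrtc is the principal branch: its values have nonnegative real part, and
   sqrtc (- x) = 'i * Num.sqrt x for real x >= 0. *)
Theorem theorem4p2 (R : realType) (a b c d : int) (a_gt0 : 0 < a)
    (disc : - d = b ^+ 2 - 4 * a * c) :
  let tau : R[i] := (- b%:~R + sqrtc (- d)%:~R) / (2 * a%:~R) in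
  C_invJ_oo tau ->
  let J := kleinJ tau in
  let F := hypF J in
  (a%:~R / (pi * Num.sqrt d%:~R))%:C * (sqrtc J / sqrtc (J - 1)) =
    F ^+ 2 * ((1 - s2 tau) / 6) - J * derive1 (fun w => hypF w ^+ 2) J.
Proof.
move=> tau Ctau J F.
have [[[t0 _ _] J0 J1] _] := Ctau.
have [d0] := Im_quadratic_root a_gt0 t0; rewrite -/tau => Imtau.
pose K := @nome R @` connected_component (@invJ_lt1 R) tau.
have Kc : connected K by exact: nome_component_connected.
have Kr : K `<=` @cusp_region R := @nome_component_region R tau.
have Kcusp : forall e : R, 0 < e -> exists2 q, K q & cnorm q < e :=
  nome_component_cusp Ctau.
set q := nome tau.
have Kq : K q.
  by exists tau => //; apply: connected_component_refl; case: Ctau.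
have fg := theta_hypq Kc Kr Kcusp Kq.
have rho0 := hypq_quotient_Re_gt0 Kc Kr Kcusp Kq.
have e60 := cusp_region_eis6 (Kr _ Kq).
have tE : 1 / J = invJ q := invJ_nome tau.
have J1' : cnorm (1 / J) < 1 by rewrite -ltcR.
rewrite derive1_hypF_sqr // /F hypF_hyp tE -/(hypq 0 q) -/(hypq 1 q).
have rho2 := hypq_quotient_sqr Kc Kr Kcusp Kq; rewrite -tE in rho2.
rewrite (sqrtc_ratio J0 J1' rho0 rho2).
rewrite /s2 E2_eis2 E4_eis4 E6_eis6 -/q.
have -> : hypq 1 q = (eis2 q * eis4 q - eis6 q) * hypq 0 q / (12 * eis6 q).
  by rewrite -fg; move: (hypq 1 q) (eis6 q) e60 => x y y0; field.
(* The term of s2 that is not holomorphic in tau is expressed by the constant on the left. *)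
have -> : (3 / (pi * complex.Im tau))%:C =
    6 * (a%:~R / (pi * Num.sqrt d%:~R))%:C :> R[i].
  rewrite -(rmorph_nat (real_complex R) 6) -rmorphM; congr (_%:C).
  have s0 : Num.sqrt (d%:~R : R) != 0 by rewrite sqrtr_eq0 -ltNge.
  have a0 : (a%:~R : R) != 0 by rewrite intr_eq0 gt_eqF.
  have p0 : (pi : R) != 0 by rewrite gt_eqF ?pi_gt0.
  rewrite Imtau; move: (Num.sqrt _) (a%:~R : R) (pi : R) s0 a0 p0 => s x p s0 x0 p0.
  by field; rewrite s0 x0 p0.
(* With k = a / (pi sqrt d) both sides equal k F^2 E4 / E6: the contributions of E2 and of the
   constant 1/6 cancel. *)
move: (_%:C) (hypq 0 q) (eis2 q) (eis4 q) (eis6 q) e60 => k f x y z z0.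
by field.
Qed.
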